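(* Let $L\in\mathcal{L}$ be such that $L$ and $L^*$ have order continuous norms. Let $A_1,\dots,A_m$ be nonnegative matrices that define operators on $L$ and let $\alpha_1,\dots,\alpha_m$ be positive numbers with $\sum_{j=1}^m\alpha_j\ge1$. Then $$\gamma(A_1^{(\alpha_1)}\circ\cdots\circ A_m^{(\alpha_m)})\le\gamma(A_1)^{\alpha_1}\cdots\gamma(A_m)^{\alpha_m}$$ and $$\rho_{ess}(A_1^{(\alpha_1)}\circ\cdots\circ A_m^{(\alpha_m)})\le\rho_{ess}(A_1)^{\alpha_1}\cdots\rho_{ess}(A_m)^{\alpha_m}.$$
   Context: Let $R=\mathbb{N}$ or $R=\{1,\dots,N\}$. A Banach sequence space is a Banach space $L$ of complex sequences indexed by $R$ such that if $x$ is a complex sequence, $y\in L$ and $|x|\le|y|$ entrywise, then $x\in L$ and $\|x\|_L\le\|y\|_L$. $\mathcal{L}$ is the class of Banach sequence spaces containing every standard unit vector $e_n$ with $\|e_n\|_L=1$. A Banach lattice has order continuous norm if every decreasing net $0\le f_\alpha\downarrow0$ satisfies $\|f_\alpha\|\to0$; $L^*$ is the Banach dual of $L$. A nonnegative matrix $A=[a_{ij}]_{i,j\in R}$ defines an operator on $L$ if for every $x\in L$ the sums $(Ax)_i=\sum_j a_{ij}x_j$ converge absolutely and $Ax\in L$. Hadamard power: $A^{(t)}=[a_{ij}^t]$; Hadamard product: $A\circ B=[a_{ij}b_{ij}]$. (It is known that when $\sum\alpha_j\ge1$ the matrix $A_1^{(\alpha_1)}\circ\cdots\circ A_m^{(\alpha_m)}$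 defines an operator on $L$.) $\gamma(T)=\inf\{\delta>0: T(D_L)\subseteq M+\delta D_L\text{ for some finite }M\subset L\}$ is the Hausdorff measure of noncompactness ($D_L$ the closed unit ball), and $\rho_{ess}(T)$ is the essential spectral radius (spectral radius of the image of $T$ in the Calkin algebra). *)

(* Defs.v *)
From Stdlib Require Import Reals Lra List.
From Coquelicot Require Import Coquelicot.
Open Scope R_scope.

(* [None] encodes R = N (indices 0,1,2,...);
   [Some N] encodes a finite index set with N+1 elements {0,...,N}
   (the paper's {1,...,N'} with N' = N+1, shifted to start at 0). *)
Definition IndexSet := option nat.
Definition inI (I : IndexSet) (n : nat) : bool :=
  match I with None => true | Some N => Nat.leb n N end.

Definition cseq := nat -> C.
Definition csub (x y : cseq) : cseq := fun i => Cminus (x i) (y i).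
Definition cadd (x y : cseq) : cseq := fun i => Cplus (x i) (y i).
Definition cscale (c : C) (x : cseq) : cseq := fun i => Cmult c (x i).
Definition czero : cseq := fun _ => RtoC 0.
Definition unitvec (n : nat) : cseq :=
  fun k => if Nat.eqb k n then RtoC 1 else RtoC 0.
Definition supported (I : IndexSet) (x : cseq) : Prop :=
  forall n, inI I n = false -> x n = RtoC 0.

Definition realseq (x : cseq) : Prop := forall n, snd (x n) = 0.
Definition nonnegseq (x : cseq) : Prop := forall n, 0 <= fst (x n) /\ snd (x n) = 0.

Definition in_calL (I : IndexSet) (L : cseq -> Prop) (nrm : cseq -> R) : Prop :=
  (forall x, L x -> supported I x) /\
  L czero /\
  (forall x y, L x -> L y -> L (cadd x y)) /\
  (forall c x, L x -> L (cscale c x)) /\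
  (forall x, L x -> 0 <= nrm x) /\
  (forall x, L x -> nrm x = 0 -> forall n, x n = RtoC 0) /\
  (forall c x, L x -> nrm (cscale c x) = Cmod c * nrm x) /\
  (forall x y, L x -> L y -> nrm (cadd x y) <= nrm x + nrm y) /\
  (forall xs : nat -> cseq, (forall n, L (xs n)) ->
     (forall eps, 0 < eps -> exists N, forall p q, (N <= p)%nat -> (N <= q)%nat ->
         nrm (csub (xs p) (xs q)) < eps) ->
     exists y, L y /\ forall eps, 0 < eps -> exists N, forall n, (N <= n)%nat ->
         nrm (csub (xs n) y) < eps) /\
  (forall x y, supported I x -> L y -> (forall n, Cmod (x n) <= Cmod (y n)) ->
     L x /\ nrm x <= nrm y) /\
  (forall n, inI I n = true -> L (unitvec n) /\ nrm (unitvec n) = 1).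

Definition directed (D : Type) (leD : D -> D -> Prop) : Prop :=
  inhabited D /\ (forall d, leD d d) /\
  (forall a b c, leD a b -> leD b c -> leD a c) /\
  (forall a b, exists c, leD a c /\ leD b c).

Definition order_continuous (L : cseq -> Prop) (nrm : cseq -> R) : Prop :=
  forall (D : Type) (leD : D -> D -> Prop) (f : D -> cseq),
    directed D leD ->
    (forall d, L (f d) /\ nonnegseq (f d)) ->
    (forall d d', leD d d' -> forall n, fst (f d' n) <= fst (f d n)) ->
    (forall y, L y -> realseq y -> (forall d n, fst (y n) <= fst (f d n)) ->
       forall n, fst (y n) <= 0) ->
    forall eps, 0 < eps -> exists d0, forall d, leD d0 d -> nrm (f d) < eps.

Definition bounded_functional (L : cseq -> Prop) (nrm : cseq -> R) (phi : cseq -> C) : Prop :=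
  (forall x y, L x -> L y -> phi (cadd x y) = Cplus (phi x) (phi y)) /\
  (forall c x, L x -> phi (cscale c x) = Cmult c (phi x)) /\
  (exists c, forall x, L x -> Cmod (phi x) <= c * nrm x).

Definition real_functional L nrm (phi : cseq -> C) : Prop :=
  bounded_functional L nrm phi /\ forall x, L x -> realseq x -> snd (phi x) = 0.

Definition fun_le (L : cseq -> Prop) (g f : cseq -> C) : Prop :=
  forall x, L x -> nonnegseq x -> fst (g x) <= fst (f x).

Definition positive_functional L nrm (phi : cseq -> C) : Prop :=
  real_functional L nrm phi /\ fun_le L (fun _ => RtoC 0) phi.

Definition dual_norm (L : cseq -> Prop) (nrm : cseq -> R) (phi : cseq -> C) : R :=
  real (Lub_Rbar (fun r => exists x, L x /\ nrm x <= 1 /\ r = Cmod (phi x))).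

Definition dual_order_continuous (L : cseq -> Prop) (nrm : cseq -> R) : Prop :=
  forall (D : Type) (leD : D -> D -> Prop) (f : D -> cseq -> C),
    directed D leD ->
    (forall d, positive_functional L nrm (f d)) ->
    (forall d d', leD d d' -> fun_le L (f d') (f d)) ->
    (forall g, real_functional L nrm g -> (forall d, fun_le L g (f d)) ->
       fun_le L g (fun _ => RtoC 0)) ->
    forall eps, 0 < eps -> exists d0, forall d, leD d0 d -> dual_norm L nrm (f d) < eps.

Definition rmatrix := nat -> nat -> R.
Definition nonneg_matrix (a : rmatrix) : Prop := forall i j, 0 <= a i j.

Definition matapp (I : IndexSet) (a : rmatrix) (x : cseq) : cseq :=
  fun i => if inI I i
           then (Series (fun j => a i j * fst (x j)), Series (fun j => a i j * snd (x j)))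
           else RtoC 0.

Definition defines_op (I : IndexSet) (L : cseq -> Prop) (a : rmatrix) : Prop :=
  forall x, L x ->
    (forall i, inI I i = true -> ex_series (fun j => a i j * Cmod (x j))) /\
    L (matapp I a x).

Definition rpow (x t : R) : R :=
  match Rle_dec x 0 with left _ => 0 | right _ => Rpower x t end.

Fixpoint bigprod (m : nat) (f : nat -> R) : R :=
  match m with O => 1 | S m' => bigprod m' f * f m' end.
Fixpoint bigsum (m : nat) (f : nat -> R) : R :=
  match m with O => 0 | S m' => bigsum m' f + f m' end.

Definition hadamard (m : nat) (A : nat -> rmatrix) (alpha : nat -> R) : rmatrix :=
  fun i j => bigprod m (fun k => rpow (A k i j) (alpha k)).

Definition bounded_op (L : cseq -> Prop) (nrm : cseq -> R) (T : cseq -> cseq) : Prop :=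
  (forall x, L x -> L (T x)) /\
  (forall x y, L x -> L y -> forall i, T (cadd x y) i = cadd (T x) (T y) i) /\
  (forall c x, L x -> forall i, T (cscale c x) i = cscale c (T x) i) /\
  (exists c, forall x, L x -> nrm (T x) <= c * nrm x).

Definition gammaH (L : cseq -> Prop) (nrm : cseq -> R) (T : cseq -> cseq) : R :=
  real (Glb_Rbar (fun delta => 0 < delta /\
     exists M : list cseq, List.Forall L M /\
       forall x, L x -> nrm x <= 1 ->
         exists y z, List.In y M /\ L z /\ nrm z <= delta /\
                     forall i, T x i = Cplus (y i) (z i))).

Definition compact_op (L : cseq -> Prop) (nrm : cseq -> R) (T : cseq -> cseq) : Prop :=
  bounded_op L nrm T /\
  forall xs : nat -> cseq, (forall n, L (xs n) /\ nrm (xs n) <= 1) ->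
    exists (phi : nat -> nat) (y : cseq),
      (forall n, (phi n < phi (S n))%nat) /\ L y /\
      forall eps, 0 < eps -> exists N, forall n, (N <= n)%nat ->
        nrm (csub (T (xs (phi n))) y) < eps.

(* lambda lies in the spectrum of the image of T in the Calkin algebra
   B(L)/K(L): T - lambda I is not invertible modulo compact operators *)
Definition ess_spectrum (L : cseq -> Prop) (nrm : cseq -> R) (T : cseq -> cseq) (lam : C) : Prop :=
  let Tl := fun x => csub (T x) (cscale lam x) in
  ~ exists S : cseq -> cseq, bounded_op L nrm S /\
      compact_op L nrm (fun x => csub (Tl (S x)) x) /\
      compact_op L nrm (fun x => csub (S (Tl x)) x).

(* essential spectral radius (0 if the essential spectrum is empty,
   i.e. if the Calkin algebra is trivial) *)
Definition rho_ess (L : cseq -> Prop) (nrm : cseq -> R) (T : cseq -> cseq) : R :=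
  real (Lub_Rbar (fun r => r = 0 \/ exists lam, ess_spectrum L nrm T lam /\ r = Cmod lam)).

(* Main.v *)
(** Order continuity of the norm makes the tail projections 1 - P_n converge strongly to 0,
    so gamma(T) = lim |(1 - P_n) T|: gamma is the norm of T modulo the compact operators,
    and for positive operators it depends monotonically on the matrix entries.  Weighted
    AM-GM bounds the tail of the Hadamard product by a weighted sum of the tails of the
    factors, each divided by its norm, which is the first inequality.

    By Hoelder's inequality the n-th power of the Hadamard product is entrywise dominated by
    the Hadamard product of the n-th powers, so the second inequality follows once the
    essential spectral radius of a positive A is known to be inf_n gamma(A^n)^(1/n).  That it
    is not larger is the Neumann series.  For the converse let rho be this infimum, assume
    that rho - A has an inverse b modulo compacts, and let
    S = sum_(l<m) A^l / lam^(l+1) with lam slightly above rho and m large: then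
    gamma(S) <= 4 gamma(b), whereas S^2 >= (n+1) A^n / lam^(n+2) gives
    gamma(S)^2 >= (n+1) rho^n / lam^(n+2) for every n, which is absurd.  Positivity thus
    replaces complex analysis. *)
Require Import Defs.
From Stdlib Require Import Reals Lra Lia List Classical ClassicalEpsilon
  FunctionalExtensionality.
From Coquelicot Require Import Coquelicot.
Open Scope R_scope.

(** Matrix powers are never multiplied out: an operator is read through its columns [T (unitvec j)],
    which determine it because finitely supported vectors are dense. In the resolvent argument a
    finite sum S is enough, since the remainder A^m / lam^m only has to satisfy gamma <= 1; no
    convergent series in the Calkin algebra is formed. Squaring S is the decisive point. S alone
    dominates A^n / lam^(n+1), which only yields a lower bound of about 1/rho and contradicts
    nothing. In the square of a geometric sum the n-th power occurs n+1 times, and a bound that is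
    uniform in n cannot accommodate that factor. *)

Ltac cseq_ring :=
  apply functional_extensionality; intro;
  unfold cadd, csub, cscale, czero; ring.

(** * Truncations, moduli and finite sums of sequences *)

Definition head (N : nat) (x : cseq) : cseq :=
  fun i => if Nat.ltb i N then x i else RtoC 0.
Definition tail (N : nat) (x : cseq) : cseq :=
  fun i => if Nat.ltb i N then RtoC 0 else x i.
Definition cabs (x : cseq) : cseq := fun i => RtoC (Cmod (x i)).

Fixpoint vsum (n : nat) (F : nat -> cseq) : cseq :=
  match n with O => czero | S n' => cadd (vsum n' F) (F n') end.

(** The inner condition of [gammaH] verbatim, so that [fold] recognises it there. *)
Definition covered (L : cseq -> Prop) (nrm : cseq -> R) (T : cseq -> cseq)
  (delta : R) : Prop :=
  exists M : list cseq, List.Forall L M /\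
    forall x, L x -> nrm x <= 1 ->
      exists y z, List.In y M /\ L z /\ nrm z <= delta /\
                  forall i, T x i = Cplus (y i) (z i).

Definition positive_op (L : cseq -> Prop) (nrm : cseq -> R) (T : cseq -> cseq) :=
  bounded_op L nrm T /\ forall x, L x -> nonnegseq x -> nonnegseq (T x).

Lemma Cmod_real_nonneg (z : C) : 0 <= fst z -> snd z = 0 -> Cmod z = fst z.
Proof.
  destruct z as [a b]; simpl; intros Ha ->.
  change (a, 0) with (RtoC a). rewrite Cmod_R. now apply Rabs_pos_eq.
Qed.

Lemma fst_cscale_R (r : R) (x : cseq) (i : nat) :
  fst (cscale (RtoC r) x i) = r * fst (x i).
Proof. unfold cscale. simpl. ring. Qed.

Lemma Cmod_cabs (x : cseq) (i : nat) : Cmod (cabs x i) = Cmod (x i).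
Proof.
  unfold cabs. rewrite Cmod_R. apply Rabs_pos_eq, Cmod_ge_0.
Qed.

Lemma cabs_nonneg (x : cseq) : nonnegseq (cabs x).
Proof. intro n; split; [apply Cmod_ge_0 | reflexivity]. Qed.

Lemma unitvec_nonneg (j : nat) : nonnegseq (unitvec j).
Proof.
  intro i. unfold unitvec. destruct (Nat.eqb i j); simpl; split; lra.
Qed.

Lemma head_add_tail (N : nat) (x : cseq) : cadd (head N x) (tail N x) = x.
Proof.
  apply functional_extensionality; intro i. unfold cadd, head, tail.
  destruct (Nat.ltb i N); ring.
Qed.

Lemma tail_add (N : nat) (x y : cseq) : tail N (cadd x y) = cadd (tail N x) (tail N y).
Proof.
  apply functional_extensionality; intro i. unfold cadd, tail.
  destruct (Nat.ltb i N); ring.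
Qed.

Lemma tail_scale (N : nat) (c : C) (x : cseq) : tail N (cscale c x) = cscale c (tail N x).
Proof.
  apply functional_extensionality; intro i. unfold cscale, tail.
  destruct (Nat.ltb i N); ring.
Qed.

Lemma head_add (N : nat) (x y : cseq) : head N (cadd x y) = cadd (head N x) (head N y).
Proof.
  apply functional_extensionality; intro i. unfold cadd, head.
  destruct (Nat.ltb i N); ring.
Qed.

Lemma head_scale (N : nat) (c : C) (x : cseq) : head N (cscale c x) = cscale c (head N x).
Proof.
  apply functional_extensionality; intro i. unfold cscale, head.
  destruct (Nat.ltb i N); ring.
Qed.

Lemma head_S (N : nat) (x : cseq) :
  head (S N) x = cadd (head N x) (cscale (x N) (unitvec N)).
Proof.
  apply functional_extensionality; intro i. unfold head, cadd, cscale, unitvec.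
  destruct (Nat.ltb_spec i (S N)); destruct (Nat.ltb_spec i N);
    destruct (Nat.eqb_spec i N); subst; try lia; ring.
Qed.

Lemma head_0 (x : cseq) : head 0 x = czero.
Proof. reflexivity. Qed.

(** * Finite nets, subsequences and elementary growth estimates *)

Lemma real_net (a e : R) : 0 < e ->
  exists l : list R, forall r, Rabs r <= a -> exists s, In s l /\ Rabs (r - s) <= e.
Proof.
  intro He.
  (* The net is the grid -a + k e; induction on the number of grid steps avoids rounding. *)
  assert (H : forall K : nat, exists l : list R, forall r, - a <= r <= - a + INR K * e ->
    exists s, In s l /\ Rabs (r - s) <= e).
  { induction K as [|K [l Hl]].
    - exists (- a :: nil). simpl. intros r Hr. exists (- a). split; auto.
      replace (r - - a) with 0 by lra. rewrite Rabs_R0. lra.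
    - exists ((- a + INR K * e) :: l). intros r Hr. rewrite S_INR in Hr.
      destruct (Rle_dec r (- a + INR K * e)) as [Hle|Hgt].
      + destruct (Hl r) as (s & Hs & Hd); [lra|]. exists s. split; [now right|auto].
      + eexists. split; [now left|]. rewrite Rabs_pos_eq; lra. }
  destruct (INR_unbounded (2 * a / e)) as [K HK].
  destruct (H K) as [l Hl]. exists l. intros r Hr. apply Hl.
  apply Rabs_le_between in Hr.
  apply (Rmult_lt_compat_r e) in HK; auto.
  replace (2 * a / e * e) with (2 * a) in HK by (field; lra). lra.
Qed.

Lemma Cmod_le_sum (z : C) : Cmod z <= Rabs (fst z) + Rabs (snd z).
Proof.
  destruct z as [a b]. unfold Cmod; simpl fst; simpl snd.
  assert (P := Rabs_pos a). assert (Q := Rabs_pos b).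
  rewrite <- (sqrt_Rsqr (Rabs a + Rabs b)) by lra. apply sqrt_le_1_alt.
  rewrite <- (pow2_abs a), <- (pow2_abs b). unfold Rsqr. nra.
Qed.

Lemma complex_net (a e : R) : 0 < e ->
  exists l : list C, forall z, Cmod z <= a -> exists w, In w l /\ Cmod (Cminus z w) <= e.
Proof.
  intro He. destruct (real_net a (e / 2)) as [l Hl]; [lra|].
  exists (list_prod l l). intros [x y] Hz.
  assert (M := Rmax_Cmod (x, y)). simpl in M.
  destruct (Hl x) as (s & Hs & Hsd).
  { eapply Rle_trans; [|exact Hz]. eapply Rle_trans; [apply Rmax_l|exact M]. }
  destruct (Hl y) as (t & Ht & Htd).
  { eapply Rle_trans; [|exact Hz]. eapply Rle_trans; [apply Rmax_r|exact M]. }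
  exists (s, t). split; [now apply in_prod|].
  eapply Rle_trans; [apply Cmod_le_sum|]. simpl. unfold Rminus in *. lra.
Qed.

Lemma eventually_all m (P : nat -> nat -> Prop) :
  (forall k, (k < m)%nat -> exists N, forall n, (N <= n)%nat -> P k n) ->
  exists N, forall k, (k < m)%nat -> P k N.
Proof.
  intro H. assert (HN : exists N, forall n, (N <= n)%nat -> forall k, (k < m)%nat -> P k n).
  { induction m as [|m IH]; [exists 0%nat; intros; lia|].
    destruct IH as [N HN]; [auto|]. destruct (H m) as [N' HN']; [lia|].
    exists (max N N'). intros n Hn k Hk. destruct (Nat.eq_dec k m) as [->|Hne].
    - apply HN'. lia.
    - apply HN; lia. }
  destruct HN as [N HN]. exists N. auto.
Qed.

(** Subsequences are carried as infinite index sets, which are easy to refine; a strictly increasing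
    map is extracted only in [diagonal_subsequence]. *)
Definition infinite (P : nat -> Prop) : Prop := forall N, exists n, (N <= n)%nat /\ P n.

(** If the class of the first element is finite, discarding the indices below its bound leaves an
    infinite set handled by the rest of the list. *)
Lemma infinite_pigeonhole {A : Type} (l : list A) (P : nat -> Prop) (Q : A -> nat -> Prop) :
  infinite P -> (forall n, P n -> exists y, In y l /\ Q y n) ->
  exists y, In y l /\ infinite (fun n => P n /\ Q y n).
Proof.
  revert P. induction l as [|y l IH]; intros P HP H.
  - destruct (HP 0%nat) as (n & _ & Hn). destruct (H n Hn) as (y & [] & _).
  - destruct (classic (infinite (fun n => P n /\ Q y n))) as [Hi|Hi].
    + exists y. split; [now left|exact Hi].
    + apply not_all_ex_not in Hi. destruct Hi as [N HN].
      destruct (IH (fun n => P n /\ (N <= n)%nat)) as (z & Hz & Hinf).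
      * intro K. destruct (HP (max N K)) as (n & Hn & HPn). exists n. split; [lia|].
        split; [auto|lia].
      * intros n [HPn HNn]. destruct (H n HPn) as (z & [<-|Hz] & HQ).
        -- exfalso. apply HN. exists n. auto.
        -- exists z. auto.
      * exists z. split; [now right|]. intro K. destruct (Hinf K) as (n & ? & [? ?] & ?).
        exists n. auto.
Qed.

(** Cantor's diagonal argument. In the application [D k p q] says that the p-th and q-th images are
    within 1/(k+1) of each other. *)
Lemma diagonal_subsequence (D : nat -> nat -> nat -> Prop) :
  (forall k P, infinite P -> exists P', infinite P' /\ (forall n, P' n -> P n) /\
     forall p q, P' p -> P' q -> D k p q) ->
  exists phi : nat -> nat, (forall n, (phi n < phi (S n))%nat) /\
    forall k p q, (k <= p)%nat -> (k <= q)%nat -> D k (phi p) (phi q).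
Proof.
  intro H.
  set (step := fun k (P : {P | infinite P}) =>
    constructive_indefinite_description _ (H k (proj1_sig P) (proj2_sig P))).
  set (Inf := {P : nat -> Prop | infinite P}).
  set (start := exist infinite (fun _ => True) (fun N =>
    ex_intro _ N (conj (Nat.le_refl N) Logic.I)) : Inf).
  set (P := fun k => nat_rect (fun _ => Inf) start
    (fun k Q => exist infinite (proj1_sig (step k Q)) (proj1 (proj2_sig (step k Q)))) k).
  set (pick := fun k N => proj1_sig (constructive_indefinite_description _
    (proj2_sig (P k) N))).
  assert (Hpick : forall k N, (N <= pick k N)%nat /\ proj1_sig (P k) (pick k N))
    by (intros k N; exact (proj2_sig (constructive_indefinite_description _
       (proj2_sig (P k) N)))).
  assert (HP : forall k, (forall n, proj1_sig (P (S k)) n -> proj1_sig (P k) n) /\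
    forall p q, proj1_sig (P (S k)) p -> proj1_sig (P (S k)) q -> D k p q)
    by (intro k; exact (proj2 (proj2_sig (step k (P k))))).
  (* [phi n] is taken in stage [S n], the first stage on which [D n] holds, and beyond the previous
     value. *)
  set (phi := fix phi n := match n with O => pick 1%nat O
    | S n' => pick (S (S n')) (S (phi n')) end).
  assert (Hphi : forall n, proj1_sig (P (S n)) (phi n)) by (intros [|n]; apply Hpick).
  assert (Hsub : forall j k n, proj1_sig (P (j + k)%nat) n -> proj1_sig (P k) n).
  { induction j as [|j IH]; intros k n Hn; auto. apply IH. now apply HP. }
  exists phi. split.
  - intro n. exact (proj1 (Hpick (S (S n)) (S (phi n)))).
  - intros k p q Hp Hq. apply HP.
    + apply (Hsub (p - k)%nat). replace (p - k + S k)%nat with (S p) by lia. apply Hphi.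
    + apply (Hsub (q - k)%nat). replace (q - k + S k)%nat with (S q) by lia. apply Hphi.
Qed.

Lemma exp_le (x y : R) : x <= y -> exp x <= exp y.
Proof. intros [H| ->]; [left; now apply exp_increasing | right; reflexivity]. Qed.

(** As 1 + t <= exp t, it suffices that N t <= ln 2; dividing by [S N] instead of [N] covers N = 0.
    This decides how close lam has to be to rho. *)
Lemma small_growth (N : nat) (d : R) : 0 < d ->
  exists t, 0 < t /\ t <= d /\ (1 + t) ^ N <= 2.
Proof.
  intro Hd. set (t := Rmin d (ln 2 / INR (S N))).
  assert (Hln : 0 < ln 2) by (rewrite <- ln_1; apply ln_increasing; lra).
  assert (HN : 0 < INR (S N)) by (apply lt_0_INR; lia).
  assert (Ht : 0 < t) by (apply Rmin_pos; [lra | now apply Rdiv_lt_0_compat]).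
  exists t. split; auto. split; [apply Rmin_l|].
  apply Rle_trans with (exp t ^ N).
  - apply pow_incr. split; [lra | apply exp_ineq1_le].
  - rewrite <- Rpower_pow by apply exp_pos. unfold Rpower. rewrite ln_exp.
    rewrite <- (exp_ln 2) by lra. apply exp_le.
    assert (Hle : t <= ln 2 / INR (S N)) by apply Rmin_r.
    apply (Rmult_le_compat_l (INR (S N))) in Hle; [|lra].
    replace (INR (S N) * (ln 2 / INR (S N))) with (ln 2) in Hle by (field; lra).
    rewrite S_INR in Hle. lra.
Qed.

Lemma pow_lt_compat (x y : R) (n : nat) : 0 <= x -> x < y -> (1 <= n)%nat -> x ^ n < y ^ n.
Proof.
  intros Hx Hy Hn. induction Hn as [|n Hn IH]; [rewrite !pow_1; exact Hy|].
  simpl. apply Rmult_le_0_lt_compat; auto. now apply pow_le.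
Qed.

Lemma iter_mul {A : Type} (f : A -> A) (m n : nat) :
  Nat.iter (m * n) f = Nat.iter n (Nat.iter m f).
Proof.
  apply functional_extensionality. intro x. induction n as [|n IH].
  - now rewrite Nat.mul_0_r.
  - rewrite Nat.mul_succ_r, Nat.add_comm, Nat.iter_add, IH. reflexivity.
Qed.

(** * Weighted arithmetic-geometric means and Hoelder's inequality *)

Lemma Rpower_1_base (t : R) : Rpower 1 t = 1.
Proof. unfold Rpower. now rewrite ln_1, Rmult_0_r, exp_0. Qed.

Lemma rpow_pos (x t : R) : 0 < x -> rpow x t = Rpower x t.
Proof. intro Hx. unfold rpow. destruct (Rle_dec x 0); [lra|reflexivity]. Qed.

Lemma rpow_npos (x t : R) : x <= 0 -> rpow x t = 0.
Proof. intro Hx. unfold rpow. destruct (Rle_dec x 0); [reflexivity|lra]. Qed.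

Lemma rpow_ge0 (x t : R) : 0 <= rpow x t.
Proof. unfold rpow. destruct (Rle_dec x 0); [lra|]. apply Rlt_le, exp_pos. Qed.

Lemma rpow_mult (x y t : R) : 0 <= x -> 0 <= y -> rpow (x * y) t = rpow x t * rpow y t.
Proof.
  intros [Hx| <-]; [|intros _; rewrite Rmult_0_l, (rpow_npos 0) by lra; ring].
  intros [Hy| <-]; [|rewrite Rmult_0_r, (rpow_npos 0) by lra; ring].
  rewrite !rpow_pos by (auto; now apply Rmult_lt_0_compat).
  now rewrite Rpower_mult_distr.
Qed.

Lemma rpow_le (x y t : R) : 0 <= t -> x <= y -> rpow x t <= rpow y t.
Proof.
  intros Ht Hxy. destruct (Rle_lt_dec x 0) as [Hx|Hx].
  - rewrite rpow_npos by auto. apply rpow_ge0.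
  - rewrite !rpow_pos by lra. apply Rle_Rpower_l; auto.
Qed.

Lemma rpow_pow (x t : R) (n : nat) : 0 <= x -> rpow (x ^ n) t = rpow x t ^ n.
Proof.
  intro Hx. induction n as [|n IH]; simpl.
  - rewrite rpow_pos by lra. apply Rpower_1_base.
  - rewrite rpow_mult, IH by auto using pow_le. reflexivity.
Qed.

(** Concavity of the logarithm in the form ln u <= u - 1, the source of the mean inequality
    below. *)
Lemma rpow_le_exp (u t : R) : 0 <= t -> rpow u t <= exp (t * (u - 1)).
Proof.
  intro Ht. unfold rpow. destruct (Rle_dec u 0); [apply Rlt_le, exp_pos|].
  unfold Rpower. apply exp_le, Rmult_le_compat_l; auto.
  assert (P := exp_ineq1_le (ln u)). rewrite exp_ln in P; lra.
Qed.

Lemma rpow_continuity (t g : R) : 0 < t -> 0 <= g -> continuity_pt (fun x => rpow x t) g.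
Proof.
  intros Ht [Hg| <-].
  - apply (continuity_pt_ext_loc (fun x => Rpower x t)).
    + exists (mkposreal g Hg). intros y Hy. symmetry. apply rpow_pos.
      apply Rabs_def2 in Hy. unfold minus, plus, opp in Hy. simpl in Hy. lra.
    + apply continuity_pt_filterlim. apply (ex_derive_continuous (fun x => Rpower x t)).
      unfold Rpower. auto_derive. exact Hg.
  (* At 0 the convention [rpow 0 t = 0] agrees with the limit because t > 0; delta is eps^(1/t). *)
  - intros eps Heps. exists (Rpower eps (/ t)). split; [apply exp_pos|].
    intros x [_ Hx]. unfold dist in *; simpl in *; unfold Rdist in *.
    rewrite (rpow_npos 0), Rminus_0_r in * by lra.
    destruct (Rle_lt_dec x 0) as [H|H].
    + rewrite rpow_npos, Rabs_R0 by auto. exact Heps.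
    + rewrite Rabs_pos_eq in Hx by lra.
      rewrite Rabs_pos_eq by apply rpow_ge0. rewrite rpow_pos by auto.
      apply Rlt_le_trans with (Rpower (Rpower eps (/ t)) t); [now apply Rlt_Rpower_l|].
      rewrite Rpower_mult, Rinv_l, Rpower_1; lra.
Qed.

Lemma bigprod_ge0 m f : (forall k, (k < m)%nat -> 0 <= f k) -> 0 <= bigprod m f.
Proof.
  induction m as [|m IH]; simpl; intro H; [lra|]. apply Rmult_le_pos; auto.
Qed.

Lemma bigprod_le m f g : (forall k, (k < m)%nat -> 0 <= f k <= g k) ->
  bigprod m f <= bigprod m g.
Proof.
  induction m as [|m IH]; simpl; intro H; [lra|]. apply Rmult_le_compat.
  - apply bigprod_ge0. intros k Hk. apply H. lia.
  - apply H. lia.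
  - apply IH. auto.
  - apply H. lia.
Qed.

Lemma bigprod_mult m f g : bigprod m (fun k => f k * g k) = bigprod m f * bigprod m g.
Proof. induction m as [|m IH]; simpl; [ring|]. rewrite IH. ring. Qed.

Lemma bigprod_ext m f g : (forall k, (k < m)%nat -> f k = g k) -> bigprod m f = bigprod m g.
Proof. induction m as [|m IH]; simpl; intro H; auto. rewrite IH, H; auto. Qed.

Lemma bigprod_pow m f n : bigprod m (fun k => f k ^ n) = bigprod m f ^ n.
Proof.
  induction m as [|m IH]; simpl; [now rewrite pow1|]. rewrite IH. now rewrite Rpow_mult_distr.
Qed.

Lemma bigsum_le m f g : (forall k, (k < m)%nat -> f k <= g k) -> bigsum m f <= bigsum m g.
Proof.
  induction m as [|m IH]; simpl; intro H; [lra|]. apply Rplus_le_compat; auto.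
Qed.

Lemma bigsum_ext m f g : (forall k, (k < m)%nat -> f k = g k) -> bigsum m f = bigsum m g.
Proof. induction m as [|m IH]; simpl; intro H; auto. rewrite IH, H; auto. Qed.

Lemma bigsum_scal m c f : bigsum m (fun k => c * f k) = c * bigsum m f.
Proof. induction m as [|m IH]; simpl; [ring|]. rewrite IH. ring. Qed.

Lemma bigsum_plus m f g : bigsum m (fun k => f k + g k) = bigsum m f + bigsum m g.
Proof. induction m as [|m IH]; simpl; [ring|]. rewrite IH. ring. Qed.

Lemma bigsum_ge0 m f : (forall k, (k < m)%nat -> 0 <= f k) -> 0 <= bigsum m f.
Proof.
  induction m as [|m IH]; simpl; intro H; [lra|]. apply Rplus_le_le_0_compat; auto.
Qed.

(** The estimates divide by the factors, which may vanish. They are therefore proved with [g k + e]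
    in place of [g k], and continuity of [rpow] removes e. *)
Lemma le_bigprod_rpow_limit m (g alpha : nat -> R) (y : R) :
  (forall k, (k < m)%nat -> 0 < alpha k) -> (forall k, (k < m)%nat -> 0 <= g k) ->
  (forall e, 0 < e -> y <= bigprod m (fun k => rpow (g k + e) (alpha k))) ->
  y <= bigprod m (fun k => rpow (g k) (alpha k)).
Proof.
  intros Ha Hg H.
  assert (Hlim : is_lim_seq (fun n => bigprod m (fun k => rpow (g k + / (INR n + 1)) (alpha k)))
    (bigprod m (fun k => rpow (g k) (alpha k)))).
  { clear H. induction m as [|m IH]; simpl; [apply is_lim_seq_const|].
    apply is_lim_seq_mult'; [apply IH; auto|].
    apply (is_lim_seq_continuous (fun x => rpow x (alpha m))); [apply rpow_continuity; auto|].
    rewrite <- (Rplus_0_r (g m)) at 1. apply is_lim_seq_plus'; [apply is_lim_seq_const|].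
    apply (is_lim_seq_ext (fun n => / INR (S n))); [intro; now rewrite S_INR|].
    apply (is_lim_seq_incr_1 (fun n => / INR n)).
    replace (Finite 0) with (Rbar_inv p_infty) by auto.
    apply is_lim_seq_inv; [exact is_lim_seq_INR | discriminate]. }
  assert (P := is_lim_seq_le (fun _ => y) _ y _
    (fun n => H (/ (INR n + 1)) ltac:(apply Rinv_0_lt_compat; assert (Q := pos_INR n); lra))
    (is_lim_seq_const y) Hlim).
  exact P.
Qed.

Lemma bigprod_rpow_const m alpha M : 0 < M ->
  bigprod m (fun k => rpow M (alpha k)) = Rpower M (bigsum m alpha).
Proof.
  intro HM. induction m as [|m IH]; simpl.
  - unfold Rpower. now rewrite Rmult_0_l, exp_0.
  - now rewrite IH, rpow_pos, Rpower_plus.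
Qed.

Lemma bigprod_rpow_le_exp m alpha u : (forall k, (k < m)%nat -> 0 <= alpha k) ->
  bigprod m (fun k => rpow (u k) (alpha k)) <= exp (bigsum m (fun k => alpha k * (u k - 1))).
Proof.
  induction m as [|m IH]; simpl; intro H; [rewrite exp_0; lra|].
  rewrite exp_plus. apply Rmult_le_compat; auto using rpow_ge0, rpow_le_exp.
  apply bigprod_ge0. intros; apply rpow_ge0.
Qed.

Section WeightedMeans.

Context (m : nat) (alpha : nat -> R).
Context (Halpha : forall k, (k < m)%nat -> 0 < alpha k) (Hsum : 1 <= bigsum m alpha).

Let s := bigsum m alpha.

(* Dividing by a majorant M of the mean, the product of the [rpow (u/M) alpha] is at most
   [exp (sum alpha (u/M - 1)) <= 1]; then [M^s <= M] because [M <= 1 <= s]. *)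
Lemma weighted_amgm (u : nat -> R) : (forall k, (k < m)%nat -> 0 <= u k <= 1) ->
  bigprod m (fun k => rpow (u k) (alpha k)) <= bigsum m (fun k => alpha k / s * u k).
Proof.
  intro Hu. set (A := bigsum m _). apply le_epsilon. intros e He.
  assert (Hs : 0 < s) by (unfold s; lra).
  assert (A0 : 0 <= A).
  { apply bigsum_ge0. intros k Hk. apply Rmult_le_pos; [|now apply Hu].
    apply Rlt_le, Rdiv_lt_0_compat; auto. }
  assert (A1 : A <= 1).
  { apply Rle_trans with (bigsum m (fun k => / s * alpha k)).
    - apply bigsum_le. intros k Hk. rewrite (Rmult_comm (/ s)).
      rewrite <- (Rmult_1_r (alpha k * / s)). apply Rmult_le_compat_l; [|now apply Hu].
      apply Rlt_le, Rdiv_lt_0_compat; auto.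
    - rewrite bigsum_scal. fold s. rewrite Rinv_l; lra. }
  (* Adding e keeps M positive even if the mean A is 0. *)
  set (M := Rmin 1 (A + e)).
  assert (M0 : 0 < M) by (apply Rmin_pos; lra).
  assert (MA : A <= M) by (apply Rmin_glb; lra).
  assert (M1 : M <= 1) by apply Rmin_l.
  apply Rle_trans with M; [|apply Rmin_r].
  rewrite (bigprod_ext m _ (fun k => rpow M (alpha k) * rpow (u k / M) (alpha k))).
  - rewrite bigprod_mult.
    assert (P1 : bigprod m (fun k => rpow M (alpha k)) = Rpower M s).
    { now apply bigprod_rpow_const. }
    assert (P2 : bigprod m (fun k => rpow (u k / M) (alpha k))
      <= exp (bigsum m (fun k => alpha k * (u k / M - 1)))).
    { apply bigprod_rpow_le_exp. intros. apply Rlt_le. auto. }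
    assert (P3 : bigsum m (fun k => alpha k * (u k / M - 1)) = s / M * A - s).
    { rewrite (bigsum_ext m _ (fun k => s / M * (alpha k / s * u k) + -1 * alpha k)).
      - rewrite bigsum_plus, !bigsum_scal. fold A. fold s. ring.
      - intros k Hk. field. lra. }
    assert (P4 : s / M * A - s <= 0).
    { assert (s / M * A <= s / M * M).
      - apply Rmult_le_compat_l; auto. apply Rlt_le, Rdiv_lt_0_compat; auto.
      - replace (s / M * M) with s in H by (field; lra). lra. }
    assert (P5 : Rpower M s <= M).
    { unfold Rpower. rewrite <- (exp_ln M) at 2 by auto. apply exp_le.
      assert (ln M <= 0) by (rewrite <- ln_1; apply Rcomplements.ln_le; lra).
      unfold s in *. nra. }
    rewrite P1, P3 in *.
    assert (P6 := exp_le _ _ P4). rewrite exp_0 in P6.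
    apply Rle_trans with (M * 1); [|lra]. apply Rmult_le_compat.
    + apply Rlt_le, exp_pos.
    + apply bigprod_ge0. intros; apply rpow_ge0.
    + exact P5.
    + lra.
  - intros k Hk. rewrite <- rpow_mult.
    + f_equal. field. lra.
    + lra.
    + destruct (Hu k Hk). apply Rmult_le_pos; auto. apply Rlt_le, Rinv_0_lt_compat, M0.
Qed.

(** Each factor is normalised by an upper bound [c k]. The weights are such that putting [c k] for
    every [u k] turns the right side into the product of the powers of the [c k] (see
    [bigsum_weights]), so norm bounds [c k] for the factors give exactly the product bound. *)
Lemma weighted_amgm_scaled (u c : nat -> R) :
  (forall k, (k < m)%nat -> 0 < c k /\ 0 <= u k <= c k) ->
  bigprod m (fun k => rpow (u k) (alpha k)) <=
  bigsum m (fun k => bigprod m (fun k => rpow (c k) (alpha k)) * (alpha k / s / c k) * u k).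
Proof.
  intro H. set (G := bigprod m (fun k => rpow (c k) (alpha k))).
  rewrite (bigprod_ext m _ (fun k => rpow (c k) (alpha k) * rpow (u k / c k) (alpha k))).
  - rewrite bigprod_mult. fold G.
    rewrite (bigsum_ext m _ (fun k => G * (alpha k / s * (u k / c k)))).
    + rewrite bigsum_scal. apply Rmult_le_compat_l.
      * apply bigprod_ge0. intros; apply rpow_ge0.
      * apply weighted_amgm. intros k Hk. destruct (H k Hk) as (Hc & H0 & H1). split.
        -- apply Rmult_le_pos; auto. apply Rlt_le, Rinv_0_lt_compat, Hc.
        -- apply (Rmult_le_reg_r (c k)); auto. unfold Rdiv.
           rewrite Rmult_assoc, Rinv_l; lra.
    + intros k Hk. destruct (H k Hk) as (Hc & _). field. unfold s. lra.
  - intros k Hk. destruct (H k Hk) as (Hc & H0 & H1). rewrite <- rpow_mult.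
    + f_equal. field. lra.
    + lra.
    + apply Rmult_le_pos; auto. apply Rlt_le, Rinv_0_lt_compat, Hc.
Qed.

Lemma bigsum_weights G : bigsum m (fun k => G * (alpha k / s)) = G.
Proof.
  rewrite bigsum_scal.
  rewrite (bigsum_ext m _ (fun k => / s * alpha k)) by (intros; unfold Rdiv; ring).
  rewrite bigsum_scal. fold s. rewrite Rinv_l; [ring | unfold s; lra].
Qed.

Lemma sum_n_bigsum (w : nat -> R) (u : nat -> nat -> R) N :
  sum_n (fun l => bigsum m (fun k => w k * u k l)) N
  = bigsum m (fun k => w k * sum_n (u k) N).
Proof.
  induction N as [|N IH].
  - rewrite sum_O. apply bigsum_ext. intros. now rewrite sum_O.
  - rewrite sum_Sn, IH. unfold plus; simpl. rewrite <- bigsum_plus. apply bigsum_ext.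
    intros. rewrite sum_Sn. unfold plus; simpl. ring.
Qed.

Lemma sum_n_ge0 (u : nat -> R) N : (forall l, 0 <= u l) -> 0 <= sum_n u N.
Proof.
  intro H. induction N as [|N IH]; [rewrite sum_O; auto|].
  rewrite sum_Sn. unfold plus; simpl. specialize (H (S N)). lra.
Qed.

Lemma sum_n_ge_term (u : nat -> R) N l : (forall l, 0 <= u l) -> (l <= N)%nat ->
  u l <= sum_n u N.
Proof.
  intros H Hl. induction Hl as [|N Hl IH].
  - destruct l; [rewrite sum_O; lra|]. rewrite sum_Sn. unfold plus; simpl.
    assert (P := sum_n_ge0 u l H). lra.
  - rewrite sum_Sn. unfold plus; simpl. specialize (H (S N)). lra.
Qed.

Lemma sum_n_le_ext (u v : nat -> R) N : (forall l, (l <= N)%nat -> u l <= v l) ->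
  sum_n u N <= sum_n v N.
Proof.
  induction N as [|N IH]; intro H; [rewrite !sum_O; auto|].
  rewrite !sum_Sn. unfold plus; simpl. apply Rplus_le_compat; auto.
Qed.

(** Apply the scaled mean inequality to every term, with [c k] the whole k-th sum plus e, and add
    up. A single term never exceeds the whole sum, which is what admits exponents of total above
    1. *)
Lemma hoelder_sum (u : nat -> nat -> R) N : (forall k l, (k < m)%nat -> 0 <= u k l) ->
  sum_n (fun l => bigprod m (fun k => rpow (u k l) (alpha k))) N
  <= bigprod m (fun k => rpow (sum_n (u k) N) (alpha k)).
Proof.
  intro Hu. apply le_bigprod_rpow_limit; auto.
  { intros k Hk. apply sum_n_ge0. auto. }
  intros e He. set (c := fun k => sum_n (u k) N + e).
  assert (Hc : forall k, (k < m)%nat -> 0 < c k).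
  { intros k Hk. unfold c. assert (P := sum_n_ge0 (u k) N (fun l => Hu k l Hk)). lra. }
  set (G := bigprod m (fun k => rpow (sum_n (u k) N + e) (alpha k))).
  apply Rle_trans with
    (sum_n (fun l => bigsum m (fun k => G * (alpha k / s / c k) * u k l)) N).
  - apply sum_n_le_ext. intros l Hl. apply (weighted_amgm_scaled (fun k => u k l) c).
    intros k Hk. split; [auto|]. split; [auto|]. unfold c.
    assert (P := sum_n_ge_term (u k) N l (fun l => Hu k l Hk) Hl). lra.
  - rewrite sum_n_bigsum. apply Rle_trans with (bigsum m (fun k => G * (alpha k / s)));
      [|right; apply bigsum_weights].
    apply bigsum_le. intros k Hk. specialize (Hc k Hk).
    rewrite Rmult_assoc. apply Rmult_le_compat_l.
    + apply bigprod_ge0. intros; apply rpow_ge0.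
    + assert (Hs : 0 < s) by (unfold s; lra). specialize (Halpha k Hk).
      apply Rle_trans with (alpha k / s / c k * c k); [|right; field; lra].
      apply Rmult_le_compat_l; [|unfold c; lra].
      apply Rlt_le. repeat apply Rdiv_lt_0_compat; auto.
Qed.

End WeightedMeans.

(** * Series of nonnegative terms *)

Lemma series_le_of_partial (f : nat -> R) (b : R) : (forall l, 0 <= f l) ->
  (forall N, sum_n f N <= b) -> ex_series f /\ Series f <= b.
Proof.
  intros Hf Hb.
  assert (Hinc : forall n, sum_n f n <= sum_n f (S n)).
  { intro n. rewrite sum_Sn. unfold plus; simpl. specialize (Hf (S n)). lra. }
  destruct (ex_finite_lim_seq_incr (sum_n f) b Hinc Hb) as [l Hl].
  assert (Hs : is_series f l) by exact Hl.
  split; [now exists l|]. rewrite (is_series_unique f l Hs).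
  exact (is_lim_seq_le _ _ _ _ Hb Hl (is_lim_seq_const b)).
Qed.

Lemma sum_n_le_series (f : nat -> R) N : (forall l, 0 <= f l) -> ex_series f ->
  sum_n f N <= Series f.
Proof.
  intros Hf [l Hl]. rewrite (is_series_unique f l Hl).
  apply (is_lim_seq_incr_compare (sum_n f)); [exact Hl|].
  intro n. rewrite sum_Sn. unfold plus; simpl. specialize (Hf (S n)). lra.
Qed.

Lemma is_series_single (f : nat -> R) (j : nat) : (forall k, k <> j -> f k = 0) ->
  is_series f (f j).
Proof.
  intro H. assert (Hs : forall n, sum_n f n = if Nat.leb j n then f j else 0).
  { induction n as [|n IH].
    - rewrite sum_O. destruct j; simpl; auto.
    - rewrite sum_Sn, IH. unfold plus; simpl.
      destruct (Nat.leb_spec j n); destruct (Nat.leb_spec j (S n)); try lia.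
      + rewrite (H (S n)) by lia. ring.
      + replace j with (S n) by lia. ring.
      + rewrite (H (S n)) by lia. ring. }
  change (is_lim_seq (sum_n f) (f j)).
  apply (is_lim_seq_ext_loc (fun _ => f j)); [|apply is_lim_seq_const].
  exists j. intros n Hn. rewrite Hs. destruct (Nat.leb_spec j n); [auto|lia].
Qed.

Lemma is_series_zero : is_series (fun _ : nat => 0) 0.
Proof. now apply (is_series_single (fun _ => 0) 0). Qed.

Lemma Series_zero : Series (fun _ => 0) = 0.
Proof. exact (is_series_unique _ _ is_series_zero). Qed.

(** * Norm and lattice structure of the sequence space *)

Section SequenceSpace.

Context {I : IndexSet} {L : cseq -> Prop} {nrm : cseq -> R}.
Context (HL : in_calL I L nrm) (OC : order_continuous L nrm).

Notation bop := (bounded_op L nrm).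
Notation gam := (gammaH L nrm).
Notation cov := (covered L nrm).

Lemma L_supported x : L x -> supported I x.
Proof. apply HL. Qed.
Lemma L_zero : L czero.
Proof. apply HL. Qed.
Lemma L_add x y : L x -> L y -> L (cadd x y).
Proof. apply HL. Qed.
Lemma L_scale c x : L x -> L (cscale c x).
Proof. apply HL. Qed.
Lemma nrm_ge0 x : L x -> 0 <= nrm x.
Proof. apply HL. Qed.
Lemma nrm_eq0 x : L x -> nrm x = 0 -> x = czero.
Proof.
  intros Hx H0. apply functional_extensionality. now apply HL.
Qed.
Lemma nrm_scale c x : L x -> nrm (cscale c x) = Cmod c * nrm x.
Proof. apply HL. Qed.
Lemma nrm_add x y : L x -> L y -> nrm (cadd x y) <= nrm x + nrm y.
Proof. apply HL. Qed.
Lemma L_complete (xs : nat -> cseq) : (forall n, L (xs n)) ->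
  (forall eps, 0 < eps -> exists N, forall p q, (N <= p)%nat -> (N <= q)%nat ->
     nrm (csub (xs p) (xs q)) < eps) ->
  exists y, L y /\ forall eps, 0 < eps -> exists N, forall n, (N <= n)%nat ->
     nrm (csub (xs n) y) < eps.
Proof. apply HL. Qed.
Lemma L_unitvec j : inI I j = true -> L (unitvec j) /\ nrm (unitvec j) = 1.
Proof. apply HL. Qed.

(** Domination by an element of L already forces the support condition of the lattice axiom. *)
Lemma solid x y : L y -> (forall n, Cmod (x n) <= Cmod (y n)) ->
  L x /\ nrm x <= nrm y.
Proof.
  intros Hy H. apply HL; auto.
  intros n Hn. apply Cmod_eq_0. apply Rle_antisym; [|apply Cmod_ge_0].
  specialize (H n). rewrite (L_supported y Hy n Hn), Cmod_0 in H. exact H.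
Qed.

Lemma csub_add_opp x y : csub x y = cadd x (cscale (Copp (RtoC 1)) y).
Proof.
  apply functional_extensionality; intro i. unfold cadd, csub, cscale.
  ring.
Qed.

Lemma nrm_zero : nrm czero = 0.
Proof.
  replace czero with (cscale (RtoC 0) czero) by cseq_ring.
  rewrite nrm_scale, Cmod_0; [ring | exact L_zero].
Qed.

Lemma L_sub x y : L x -> L y -> L (csub x y).
Proof.
  intros. rewrite csub_add_opp. auto using L_add, L_scale.
Qed.

Lemma nrm_sub x y : L x -> L y -> nrm (csub x y) <= nrm x + nrm y.
Proof.
  intros Hx Hy. rewrite csub_add_opp.
  eapply Rle_trans; [apply nrm_add; auto using L_scale|].
  rewrite nrm_scale, Cmod_opp, Cmod_1 by auto. lra.
Qed.

(** The vector x_i e_i is dominated by x and has norm |x_i|, since unit vectors have norm 1. *)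
Lemma coord_le_nrm x i : L x -> Cmod (x i) <= nrm x.
Proof.
  intro Hx. destruct (inI I i) eqn:Hi.
  - destruct (L_unitvec i Hi) as [Hu Hn].
    destruct (solid (cscale (x i) (unitvec i)) x Hx) as [_ H].
    + intro n. unfold cscale, unitvec. rewrite Cmod_mult.
      destruct (Nat.eqb_spec n i); [subst; rewrite Cmod_1; lra|].
      rewrite Cmod_0, Rmult_0_r. apply Cmod_ge_0.
    + rewrite nrm_scale, Hn in H by auto. lra.
  - rewrite (L_supported x Hx i Hi), Cmod_0. now apply nrm_ge0.
Qed.

Lemma L_cabs x : L x -> L (cabs x).
Proof. intro Hx. apply (solid _ x Hx). intro; rewrite Cmod_cabs; lra. Qed.

Lemma nrm_cabs x : L x -> nrm (cabs x) = nrm x.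
Proof.
  intro Hx. apply Rle_antisym; apply solid; auto using L_cabs;
  intro; rewrite Cmod_cabs; lra.
Qed.

Lemma tail_dom N x n : Cmod (tail N x n) <= Cmod (x n).
Proof.
  unfold tail. destruct (Nat.ltb n N); [rewrite Cmod_0; apply Cmod_ge_0 | lra].
Qed.
Lemma head_dom N x n : Cmod (head N x n) <= Cmod (x n).
Proof.
  unfold head. destruct (Nat.ltb n N); [lra | rewrite Cmod_0; apply Cmod_ge_0].
Qed.
Lemma L_tail N x : L x -> L (tail N x).
Proof. intro Hx. apply (solid _ x Hx), tail_dom. Qed.
Lemma L_head N x : L x -> L (head N x).
Proof. intro Hx. apply (solid _ x Hx), head_dom. Qed.
Lemma nrm_tail N x : L x -> nrm (tail N x) <= nrm x.
Proof. intro Hx. apply (solid _ x Hx), tail_dom. Qed.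
Lemma nrm_head N x : L x -> nrm (head N x) <= nrm x.
Proof. intro Hx. apply (solid _ x Hx), head_dom. Qed.

(** Order continuity enters here: the tails of |x| decrease, and coordinate n vanishes from stage n
    + 1 on, so their infimum is 0. *)
Lemma tail_cv x : L x -> forall eps, 0 < eps ->
  exists N, forall n, (N <= n)%nat -> nrm (tail n x) < eps.
Proof.
  intros Hx eps Heps.
  destruct (OC nat le (fun n => tail n (cabs x))) with (eps := eps)
    as [N HN]; auto.
  - split; [exact (inhabits 0%nat)|]. split; [auto|]. split; [intros; lia|].
    intros a b. exists (max a b). lia.
  - intro d. split; [now apply L_tail, L_cabs|].
    intro n. unfold tail. destruct (Nat.ltb n d); simpl; [lra|].
    split; [apply Cmod_ge_0 | reflexivity].
  - intros d d' Hd n. unfold tail.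
    destruct (Nat.ltb_spec n d); destruct (Nat.ltb_spec n d'); simpl; try lra; try lia.
    apply Cmod_ge_0.
  - intros y _ _ H n. specialize (H (S n) n). unfold tail in H.
    destruct (Nat.ltb_spec n (S n)); [exact H | lia].
  - exists N. intros n Hn. specialize (HN n Hn).
    eapply Rle_lt_trans; [|exact HN].
    apply solid; [now apply L_tail, L_cabs|].
    intro k. unfold tail. destruct (Nat.ltb k n); [lra|]. rewrite Cmod_cabs. lra.
Qed.

Lemma L_vsum n F : (forall k, (k < n)%nat -> L (F k)) -> L (vsum n F).
Proof.
  induction n as [|n IH]; simpl; intro H; [exact L_zero|].
  apply L_add; auto.
Qed.

Lemma nrm_vsum n F b : (forall k, (k < n)%nat -> L (F k)) ->
  (forall k, (k < n)%nat -> nrm (F k) <= b k) -> nrm (vsum n F) <= bigsum n b.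
Proof.
  induction n as [|n IH]; simpl; intros H Hb; [rewrite nrm_zero; lra|].
  eapply Rle_trans; [apply nrm_add; auto using L_vsum|].
  assert (nrm (vsum n F) <= bigsum n b) by auto.
  specialize (Hb n (Nat.lt_succ_diag_r n)). lra.
Qed.

(** * Bounded operators *)

Lemma bop_L T x : bop T -> L x -> L (T x).
Proof. intros H; apply H. Qed.
Lemma bop_add T x y : bop T -> L x -> L y -> T (cadd x y) = cadd (T x) (T y).
Proof. intros H Hx Hy. apply functional_extensionality. now apply H. Qed.
Lemma bop_scale T c x : bop T -> L x -> T (cscale c x) = cscale c (T x).
Proof. intros H Hx. apply functional_extensionality. now apply H. Qed.
Lemma bop_bound T : bop T -> exists c, 0 < c /\ forall x, L x -> nrm (T x) <= c * nrm x.
Proof.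
  intros (_ & _ & _ & c & Hc). exists (Rabs c + 1).
  split; [assert (H := Rabs_pos c); lra|].
  intros x Hx. eapply Rle_trans; [now apply Hc|].
  apply Rmult_le_compat_r; [now apply nrm_ge0|]. assert (H := Rle_abs c). lra.
Qed.
Lemma bop_sub T x y : bop T -> L x -> L y -> T (csub x y) = csub (T x) (T y).
Proof.
  intros H Hx Hy. rewrite !csub_add_opp, (bop_add T), (bop_scale T); auto using L_scale.
Qed.
Lemma bop_zero T : bop T -> T czero = czero.
Proof.
  intro H. replace czero with (cscale (RtoC 0) czero) at 1 by cseq_ring.
  rewrite (bop_scale T) by auto using L_zero. cseq_ring.
Qed.

Lemma bop_intro T c :
  (forall x, L x -> L (T x)) ->
  (forall x y, L x -> L y -> T (cadd x y) = cadd (T x) (T y)) ->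
  (forall a x, L x -> T (cscale a x) = cscale a (T x)) ->
  (forall x, L x -> nrm (T x) <= c * nrm x) -> bop T.
Proof.
  intros H1 H2 H3 H4. split; [exact H1|]. split; [|split].
  - intros x y Hx Hy i. now rewrite H2.
  - intros a x Hx i. now rewrite H3.
  - now exists c.
Qed.

Lemma bop_id : bop (fun x => x).
Proof. apply (bop_intro _ 1); auto. intros; lra. Qed.

Lemma bop_null : bop (fun _ => czero).
Proof.
  apply (bop_intro _ 0); intros; try cseq_ring; [exact L_zero|].
  rewrite nrm_zero; lra.
Qed.

Lemma bop_comp S T : bop S -> bop T -> bop (fun x => S (T x)).
Proof.
  intros HS HT. destruct (bop_bound S HS) as (c & Hc & Sc).
  destruct (bop_bound T HT) as (d & Hd & Td).
  apply (bop_intro _ (c * d)); intros.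
  - auto using bop_L.
  - rewrite (bop_add T), (bop_add S); auto using bop_L.
  - rewrite (bop_scale T), (bop_scale S); auto using bop_L.
  - eapply Rle_trans; [apply Sc; auto using bop_L|]. rewrite Rmult_assoc.
    apply Rmult_le_compat_l; auto. lra.
Qed.

Lemma bop_plus S T : bop S -> bop T -> bop (fun x => cadd (S x) (T x)).
Proof.
  intros HS HT. destruct (bop_bound S HS) as (c & Hc & Sc).
  destruct (bop_bound T HT) as (d & Hd & Td).
  apply (bop_intro _ (c + d)); intros.
  - auto using bop_L, L_add.
  - rewrite (bop_add T), (bop_add S); auto. cseq_ring.
  - rewrite (bop_scale T), (bop_scale S); auto. cseq_ring.
  - eapply Rle_trans; [apply nrm_add; auto using bop_L|].
    specialize (Sc x H). specialize (Td x H). lra.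
Qed.

Lemma bop_cscale a T : bop T -> bop (fun x => cscale a (T x)).
Proof.
  intros HT. destruct (bop_bound T HT) as (d & Hd & Td).
  apply (bop_intro _ (Cmod a * d)); intros.
  - auto using bop_L, L_scale.
  - rewrite (bop_add T); auto. cseq_ring.
  - rewrite (bop_scale T); auto. cseq_ring.
  - rewrite nrm_scale, Rmult_assoc by auto using bop_L.
    apply Rmult_le_compat_l; auto. apply Cmod_ge_0.
Qed.

Lemma bop_minus S T : bop S -> bop T -> bop (fun x => csub (S x) (T x)).
Proof.
  intros HS HT.
  replace (fun x => csub (S x) (T x))
    with (fun x => cadd (S x) (cscale (Copp (RtoC 1)) (T x))).
  - apply bop_plus; auto using bop_cscale.
  - apply functional_extensionality; intro. now rewrite csub_add_opp.
Qed.

Lemma bop_tail N T : bop T -> bop (fun x => tail N (T x)).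
Proof.
  intros HT. destruct (bop_bound T HT) as (d & Hd & Td).
  apply (bop_intro _ d); intros.
  - auto using bop_L, L_tail.
  - rewrite (bop_add T); auto using tail_add.
  - rewrite (bop_scale T); auto using tail_scale.
  - eapply Rle_trans; [apply nrm_tail|]; auto using bop_L.
Qed.

Lemma bop_head N T : bop T -> bop (fun x => head N (T x)).
Proof.
  intros HT. destruct (bop_bound T HT) as (d & Hd & Td).
  apply (bop_intro _ d); intros.
  - auto using bop_L, L_head.
  - rewrite (bop_add T); auto using head_add.
  - rewrite (bop_scale T); auto using head_scale.
  - eapply Rle_trans; [apply nrm_head|]; auto using bop_L.
Qed.

Lemma bop_iter n T : bop T -> bop (Nat.iter n T).
Proof.
  intro HT. induction n as [|n IH]; [exact bop_id|].
  exact (bop_comp T (Nat.iter n T) HT IH).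
Qed.

Lemma bop_vsum n F : (forall k, (k < n)%nat -> bop (F k)) ->
  bop (fun x => vsum n (fun k => F k x)).
Proof.
  induction n as [|n IH]; simpl; intro H; [exact bop_null|].
  apply bop_plus; auto.
Qed.

Lemma bop_head_S T N x : bop T -> L x ->
  T (head (S N) x) = cadd (T (head N x)) (cscale (x N) (T (unitvec N))).
Proof.
  intros HT Hx. rewrite head_S. destruct (inI I N) eqn:HN.
  - destruct (L_unitvec N HN). rewrite (bop_add T), (bop_scale T); auto using L_head, L_scale.
  - rewrite (L_supported x Hx N HN).
    replace (cscale (RtoC 0) (unitvec N)) with czero by cseq_ring.
    replace (cadd (head N x) czero) with (head N x) by cseq_ring. cseq_ring.
Qed.

(** Heads of x converge to x in norm, so a bound for a bounded operator may be tested on finitely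
    supported vectors, that is, through columns. *)
Lemma nrm_op_from_heads T x b : bop T -> L x ->
  (forall M, nrm (T (head M x)) <= b) -> nrm (T x) <= b.
Proof.
  intros HT Hx H. apply le_epsilon. intros eps Heps.
  destruct (bop_bound T HT) as (c & Hc & Tc).
  destruct (tail_cv x Hx (eps / c)) as [M HM]; [now apply Rdiv_lt_0_compat|].
  specialize (HM M (Nat.le_refl M)).
  rewrite <- (head_add_tail M x), (bop_add T) by auto using L_head, L_tail.
  eapply Rle_trans; [apply nrm_add; auto using bop_L, L_head, L_tail|].
  apply Rplus_le_compat; [apply H|].
  eapply Rle_trans; [apply Tc; auto using L_tail|].
  apply Rlt_le in HM. apply (Rmult_le_compat_l c) in HM; [|lra].
  replace (c * (eps / c)) with eps in HM by (field; lra). exact HM.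
Qed.

Lemma tail_op_domination T B N c : bop T -> bop B -> 0 <= c ->
  (forall i j, (N <= i)%nat -> inI I j = true ->
     snd (B (unitvec j) i) = 0 /\ Cmod (T (unitvec j) i) <= fst (B (unitvec j) i)) ->
  (forall x, L x -> nrm (tail N (B x)) <= c * nrm x) ->
  forall x, L x -> nrm (tail N (T x)) <= c * nrm x.
Proof.
  intros HT HB Hc0 Hent HBn x Hx.
  apply (nrm_op_from_heads (fun x => tail N (T x)) x); auto using bop_tail.
  intro M.
  assert (Hi : forall i, (N <= i)%nat ->
     snd (B (head M (cabs x)) i) = 0 /\
     Cmod (T (head M x) i) <= fst (B (head M (cabs x)) i)).
  { intros i Hi. induction M as [|M IH].
    - rewrite !head_0, !bop_zero by auto. unfold czero. rewrite Cmod_0. simpl. lra.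
    - rewrite (bop_head_S T), (bop_head_S B) by auto using L_cabs.
      destruct IH as [IH1 IH2]. unfold cadd, cscale. unfold cabs at 2 4.
      destruct (inI I M) eqn:HM.
      + destruct (Hent i M Hi HM) as [E1 E2]. simpl. rewrite IH1, E1. split; [ring|].
        eapply Rle_trans; [apply Cmod_triangle|]. rewrite Cmod_mult.
        assert (P := Rmult_le_compat_l _ _ _ (Cmod_ge_0 (x M)) E2). lra.
      + rewrite (L_supported x Hx M HM), Cmod_0. simpl. rewrite IH1. split; [ring|].
        eapply Rle_trans; [apply Cmod_triangle|]. rewrite Cmod_mult, Cmod_0. lra. }
  apply Rle_trans with (nrm (tail N (B (head M (cabs x))))).
  - apply solid; [auto using L_tail, bop_L, L_head, L_cabs|].
    intro i. unfold tail. destruct (Nat.ltb_spec i N); [lra|].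
    destruct (Hi i H) as [E1 E2].
    rewrite (Cmod_real_nonneg (B _ i)); auto.
    eapply Rle_trans; [apply Cmod_ge_0 | exact E2].
  - eapply Rle_trans; [apply HBn; auto using L_head, L_cabs|].
    apply Rmult_le_compat_l; auto.
    eapply Rle_trans; [apply nrm_head; auto using L_cabs|]. rewrite nrm_cabs; auto. lra.
Qed.

(** * The Hausdorff measure of noncompactness *)

Lemma covered_of_bound T c : bop T -> (forall x, L x -> nrm (T x) <= c * nrm x) ->
  0 <= c -> cov T c.
Proof.
  intros HT H Hc. exists (czero :: nil). split; [repeat constructor; exact L_zero|].
  intros x Hx Hx1. exists czero, (T x). split; [now left|].
  split; [auto using bop_L|]. split.
  - eapply Rle_trans; [now apply H|]. rewrite <- (Rmult_1_r c) at 2.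
    now apply Rmult_le_compat_l.
  - intro i. unfold czero. ring.
Qed.

(** [gammaH] applies [real] to an extended infimum, which would give 0 at infinity. Boundedness of T
    provides an admissible radius and 0 is a lower bound, so the infimum is finite and behaves as
    expected. *)
Lemma gamma_spec T : bop T -> 0 <= gam T /\
  (forall d, 0 < d -> cov T d -> gam T <= d) /\
  (forall e, 0 < e -> cov T (gam T + e)).
Proof.
  intro HT. destruct (bop_bound T HT) as (c & Hc & Tc).
  assert (Hne : cov T c) by (apply covered_of_bound; auto; lra).
  unfold gammaH. fold (cov T).
  set (E := fun delta => 0 < delta /\ _).
  assert (HE : forall d, E d <-> 0 < d /\ cov T d) by (intro; reflexivity).
  assert (HG := Glb_Rbar_correct E). destruct HG as [Hlb Hglb].
  assert (H0 : Rbar_le 0 (Glb_Rbar E)).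
  { apply Hglb. intros d Hd. apply HE in Hd. destruct Hd. simpl. lra. }
  assert (H1 := Hlb c (proj2 (HE c) (conj Hc Hne))).
  destruct (Glb_Rbar E) as [g| |] eqn:EG; simpl in *; try easy.
  split; [exact H0|]. split.
  - intros d Hd Hcd. exact (Hlb d (proj2 (HE d) (conj Hd Hcd))).
  - intros e He. apply NNPP. intro Hn.
    assert (Hc2 : g + e <= g); [|lra].
    apply (Hglb (g + e)). intros d Hd. apply HE in Hd. destruct Hd as [Hd1 (M & HM & Hd2)]. simpl.
    apply Rnot_lt_le. intro Hlt. apply Hn. exists M. split; auto.
    intros x Hx Hx1. destruct (Hd2 x Hx Hx1) as (y & z & Hy & Hz & Hzn & Heq).
    exists y, z. repeat split; auto. lra.
Qed.

Lemma gamma_ge0 T : bop T -> 0 <= gam T.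
Proof. intro HT. now apply gamma_spec. Qed.

Lemma gamma_le_of_cov T d : bop T -> 0 <= d ->
  (forall e, 0 < e -> cov T (d + e)) -> gam T <= d.
Proof.
  intros HT Hd H. apply le_epsilon. intros e He.
  apply gamma_spec; auto. lra.
Qed.

Lemma gamma_cov T d : bop T -> gam T < d -> cov T d.
Proof.
  intros HT H. replace d with (gam T + (d - gam T)) by ring.
  apply gamma_spec; auto; lra.
Qed.

Lemma gamma_ext S T : (forall x, L x -> S x = T x) -> bop S -> bop T -> gam S = gam T.
Proof.
  intros H HS HT.
  assert (HH : forall U V, (forall x, L x -> U x = V x) -> bop U -> bop V -> gam U <= gam V).
  { intros U V HUV HU HV. apply gamma_le_of_cov; auto using gamma_ge0.
    intros e He. destruct (gamma_cov V (gam V + e) HV) as (M & HM & Hc); [lra|].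
    exists M. split; auto. intros x Hx Hx1. rewrite HUV by auto. auto. }
  apply Rle_antisym; apply HH; auto. intros; symmetry; auto.
Qed.

Lemma gamma_bound T c : bop T -> 0 <= c -> (forall x, L x -> nrm (T x) <= c * nrm x) ->
  gam T <= c.
Proof.
  intros HT Hc H. apply gamma_le_of_cov; auto. intros e He.
  apply covered_of_bound; auto; [|lra]. intros x Hx.
  eapply Rle_trans; [now apply H|]. apply Rmult_le_compat_r; [now apply nrm_ge0|lra].
Qed.

Lemma covered_plus S T a b : cov S a -> cov T b ->
  cov (fun x => cadd (S x) (T x)) (a + b).
Proof.
  intros (M & HM & Hc) (M' & HM' & Hc').
  exists (map (fun p => cadd (fst p) (snd p)) (list_prod M M')). split.
  - apply Forall_forall. intros v Hv. apply in_map_iff in Hv.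
    destruct Hv as ((u & w) & <- & Huw). apply in_prod_iff in Huw.
    rewrite Forall_forall in HM, HM'. apply L_add; [apply HM|apply HM']; easy.
  - intros x Hx Hx1. destruct (Hc x Hx Hx1) as (y & z & Hy & Hz & Hzn & Heq).
    destruct (Hc' x Hx Hx1) as (y' & z' & Hy' & Hz' & Hzn' & Heq').
    exists (cadd y y'), (cadd z z'). split.
    + apply in_map_iff. exists (y, y'). split; auto. now apply in_prod.
    + split; [auto using L_add|]. split.
      * eapply Rle_trans; [now apply nrm_add|]. lra.
      * intro i. unfold cadd. rewrite Heq, Heq'. ring.
Qed.

(** The remainder left by the cover for T is rescaled into the unit ball, covered through S, and
    scaled back; the centres are S y + b y' with y a centre for T and y' one for S. *)
Lemma covered_comp S T a b : bop S -> bop T -> 0 < b -> cov S a -> cov T b ->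
  cov (fun x => S (T x)) (a * b).
Proof.
  intros HS HT Hb (M & HM & Hc) (M' & HM' & Hc').
  exists (map (fun p => cadd (S (snd p)) (cscale (RtoC b) (fst p))) (list_prod M M')).
  rewrite Forall_forall in HM, HM'. split.
  - apply Forall_forall. intros v Hv. apply in_map_iff in Hv.
    destruct Hv as ((u & w) & <- & Huw). apply in_prod_iff in Huw. simpl.
    apply L_add; [apply bop_L; auto; now apply HM' | apply L_scale; now apply HM].
  - intros x Hx Hx1. destruct (Hc' x Hx Hx1) as (y & z & Hy & Hz & Hzn & Heq).
    assert (Hib : Cmod (RtoC (/ b)) = / b).
    { rewrite Cmod_R. apply Rabs_pos_eq. apply Rlt_le. now apply Rinv_0_lt_compat. }
    destruct (Hc (cscale (RtoC (/ b)) z)) as (y' & z' & Hy' & Hz' & Hzn' & Heq').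
    + now apply L_scale.
    + rewrite nrm_scale, Hib by auto. apply (Rmult_le_reg_l b); auto.
      rewrite <- Rmult_assoc, Rinv_r; lra.
    + exists (cadd (S y) (cscale (RtoC b) y')), (cscale (RtoC b) z'). split.
      * apply in_map_iff. exists (y', y). split; auto. now apply in_prod.
      * split; [auto using L_scale|]. split.
        -- rewrite nrm_scale, Cmod_R, Rabs_pos_eq by (auto; lra).
           rewrite (Rmult_comm a b). apply Rmult_le_compat_l; lra.
        -- intro i.
           replace (T x) with (cadd y (cscale (RtoC b) (cscale (RtoC (/ b)) z))).
           ++ rewrite (bop_add S), (bop_scale S (RtoC b)) by auto using L_scale.
              unfold cadd. unfold cscale at 1. rewrite Heq'.
              unfold cscale. ring.
           ++ apply functional_extensionality. intro k. rewrite Heq.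
              unfold cadd, cscale. rewrite Cmult_assoc, <- RtoC_mult, Rinv_r by lra. ring.
Qed.

Lemma gamma_plus S T : bop S -> bop T ->
  gam (fun x => cadd (S x) (T x)) <= gam S + gam T.
Proof.
  intros HS HT. assert (GS := gamma_ge0 S HS). assert (GT := gamma_ge0 T HT).
  apply gamma_le_of_cov; [now apply bop_plus | lra|].
  intros e He. replace (gam S + gam T + e) with ((gam S + e / 2) + (gam T + e / 2)) by field.
  apply covered_plus; apply gamma_cov; auto; lra.
Qed.

Lemma gamma_comp S T : bop S -> bop T ->
  gam (fun x => S (T x)) <= gam S * gam T.
Proof.
  intros HS HT. assert (GS := gamma_ge0 S HS). assert (GT := gamma_ge0 T HT).
  assert (H : forall e, 0 < e -> gam (fun x => S (T x)) <= (gam S + e) * (gam T + e)).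
  { intros e He. apply gamma_spec; [now apply bop_comp| |].
    - apply Rmult_lt_0_compat; lra.
    - apply covered_comp; auto; try lra; apply gamma_cov; auto; lra. }
  apply le_epsilon. intros d Hd.
  (* For e <= 1 the product (gam S + e)(gam T + e) exceeds gam S * gam T by at most e k. *)
  set (k := gam S + gam T + 1). assert (Hk : 0 < k) by (unfold k; lra).
  set (e := Rmin 1 (d / k)).
  assert (He : 0 < e) by (apply Rmin_pos; [lra | now apply Rdiv_lt_0_compat]).
  eapply Rle_trans; [exact (H e He)|].
  assert (e <= 1) by apply Rmin_l.
  assert (e * k <= d).
  { apply (Rmult_le_reg_r (/ k)); [now apply Rinv_0_lt_compat|].
    rewrite Rmult_assoc, Rinv_r, Rmult_1_r by lra. apply Rmin_r. }
  unfold k in *. nra.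
Qed.

Lemma gamma_cscale a T : bop T -> gam (fun x => cscale a (T x)) <= Cmod a * gam T.
Proof.
  intro HT. eapply Rle_trans.
  - apply (gamma_comp (fun x => cscale a x) T); auto. apply bop_cscale, bop_id.
  - apply Rmult_le_compat_r; [now apply gamma_ge0|].
    apply gamma_bound; [apply bop_cscale, bop_id | apply Cmod_ge_0|].
    intros x Hx. rewrite nrm_scale; auto. lra.
Qed.

Lemma gamma_minus S T : bop S -> bop T ->
  gam (fun x => csub (S x) (T x)) <= gam S + gam T.
Proof.
  intros HS HT.
  replace (fun x => csub (S x) (T x))
    with (fun x => cadd (S x) (cscale (Copp (RtoC 1)) (T x))).
  - eapply Rle_trans; [apply gamma_plus; auto using bop_cscale|].
    assert (H := gamma_cscale (Copp (RtoC 1)) T HT).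
    rewrite Cmod_opp, Cmod_1 in H. lra.
  - apply functional_extensionality; intro. now rewrite csub_add_opp.
Qed.

Lemma gamma_iter n T : bop T -> gam (Nat.iter n T) <= gam T ^ n.
Proof.
  intro HT. induction n as [|n IH].
  - apply gamma_bound; [exact bop_id | simpl; lra|]. intros x Hx. simpl. lra.
  - eapply Rle_trans; [exact (gamma_comp T (Nat.iter n T) HT (bop_iter n T HT))|].
    simpl. apply Rmult_le_compat_l; auto using gamma_ge0.
Qed.

Lemma tail_list_cv (M : list cseq) : List.Forall L M -> forall e, 0 < e ->
  exists N, forall n y, (N <= n)%nat -> In y M -> nrm (tail n y) < e.
Proof.
  induction 1 as [|y M Hy HM IH]; intros e He.
  - exists 0%nat. intros n y _ [].
  - destruct (IH e He) as [N HN]. destruct (tail_cv y Hy e He) as [N' HN'].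
    exists (max N N'). intros n z Hn [<-|Hz]; [apply HN' | apply HN]; auto; lia.
Qed.

Lemma nrm_le_of_ball T d : bop T -> (forall x, L x -> nrm x <= 1 -> nrm (T x) <= d) ->
  forall x, L x -> nrm (T x) <= d * nrm x.
Proof.
  intros HT H x Hx. destruct (Req_dec (nrm x) 0) as [H0|H0].
  - rewrite (nrm_eq0 x Hx H0), bop_zero, nrm_zero by auto. lra.
  - assert (Hp : 0 < nrm x) by (assert (P := nrm_ge0 x Hx); lra).
    assert (Hm : Cmod (RtoC (/ nrm x)) = / nrm x).
    { rewrite Cmod_R. apply Rabs_pos_eq, Rlt_le, Rinv_0_lt_compat, Hp. }
    assert (P := H (cscale (RtoC (/ nrm x)) x) (L_scale _ _ Hx)).
    rewrite (bop_scale T), !nrm_scale, Hm, Rinv_l in P by auto using bop_L.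
    specialize (P (Rle_refl 1)). apply (Rmult_le_compat_r (nrm x)) in P; [|lra].
    rewrite (Rmult_comm (/ nrm x)), Rmult_assoc, Rinv_l, Rmult_1_r in P by lra. exact P.
Qed.

(** The finitely many centres of a cover have uniformly small tails, and truncation does not enlarge
    the remainder; each of the two gets half of the gap d - gam T. *)
Lemma gamma_tail T d : bop T -> gam T < d ->
  exists N, forall n, (N <= n)%nat ->
    forall x, L x -> nrm (tail n (T x)) <= d * nrm x.
Proof.
  intros HT Hd. set (e := (d - gam T) / 2).
  assert (He : 0 < e) by (unfold e; lra).
  destruct (gamma_cov T (d - e) HT) as (M & HM & Hc); [unfold e; lra|].
  destruct (tail_list_cv M HM e He) as [N HN]. exists N. intros n Hn.
  apply (nrm_le_of_ball (fun x => tail n (T x))); auto using bop_tail.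
  intros x Hx Hx1. destruct (Hc x Hx Hx1) as (y & z & Hy & Hz & Hzn & Heq).
  replace (T x) with (cadd y z) by (apply functional_extensionality; intro; now rewrite Heq).
  rewrite tail_add. assert (Ly : L y) by (rewrite Forall_forall in HM; auto).
  eapply Rle_trans; [apply nrm_add; auto using L_tail|].
  assert (P := HN n y Hn Hy). assert (Q := nrm_tail n z Hz). lra.
Qed.

Lemma covered_ext S T d : (forall x, L x -> S x = T x) -> cov S d -> cov T d.
Proof.
  intros H (M & HM & Hc). exists M. split; auto.
  intros x Hx Hx1. rewrite <- H by auto. auto.
Qed.

(** The coordinate functional maps the unit ball into a disc, which has a finite net. *)
Lemma covered_coord T j e : bop T -> inI I j = true -> 0 < e ->
  cov (fun x => cscale (T x j) (unitvec j)) e.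
Proof.
  intros HT Hj He. destruct (bop_bound T HT) as (c & Hc & Tc).
  destruct (complex_net c e He) as [l Hl]. destruct (L_unitvec j Hj) as [Hu Hn].
  exists (map (fun w => cscale w (unitvec j)) l). split.
  - apply Forall_forall. intros v Hv. apply in_map_iff in Hv.
    destruct Hv as (w & <- & _). now apply L_scale.
  - intros x Hx Hx1. destruct (Hl (T x j)) as (w & Hw & Hd).
    + eapply Rle_trans; [apply coord_le_nrm; auto using bop_L|].
      eapply Rle_trans; [now apply Tc|]. nra.
    + exists (cscale w (unitvec j)), (cscale (Cminus (T x j) w) (unitvec j)).
      split; [now apply (in_map (fun w => cscale w (unitvec j)))|].
      split; [auto using L_scale|]. split; [rewrite nrm_scale, Hn; auto; lra|].
      intro i. unfold cscale. ring.
Qed.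

Lemma covered_head T N : bop T -> forall e, 0 < e -> cov (fun x => head N (T x)) e.
Proof.
  intro HT. induction N as [|N IH]; intros e He.
  - apply (covered_ext (fun _ => czero)); [reflexivity|].
    apply covered_of_bound; [exact bop_null| |lra].
    intros x Hx. rewrite nrm_zero. apply Rmult_le_pos; [lra|now apply nrm_ge0].
  - destruct (inI I N) eqn:HN.
    + apply (covered_ext (fun x => cadd (head N (T x)) (cscale (T x N) (unitvec N)))).
      * intros; now rewrite head_S.
      * replace e with (e / 2 + e / 2) by field.
        apply covered_plus; [apply IH; lra|apply covered_coord; auto; lra].
    + apply (covered_ext (fun x => head N (T x))); auto.
      intros x Hx. rewrite head_S, (L_supported _ (bop_L T x HT Hx) N HN). cseq_ring.
Qed.

Lemma gamma_head T N : bop T -> gam (fun x => head N (T x)) <= 0.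
Proof.
  intro HT. apply gamma_le_of_cov; [now apply bop_head | lra|].
  intros e He. apply covered_head; auto. lra.
Qed.

(** The head of T has finite rank and measure 0, so only the tail counts. *)
Lemma gamma_le_of_tail T N c : bop T -> 0 <= c ->
  (forall x, L x -> nrm (tail N (T x)) <= c * nrm x) -> gam T <= c.
Proof.
  intros HT Hc H.
  rewrite (gamma_ext T (fun x => cadd (head N (T x)) (tail N (T x))));
    [|intros; now rewrite head_add_tail | auto | auto using bop_plus, bop_head, bop_tail].
  eapply Rle_trans; [apply gamma_plus; auto using bop_head, bop_tail|].
  assert (P := gamma_head T N HT).
  assert (Q := gamma_bound (fun x => tail N (T x)) c (bop_tail N T HT) Hc H). lra.
Qed.

(** Covers are not visibly monotone in the operator, but norms of tails are; hence the passage
    through tails. *)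
Lemma gamma_mono T B : bop T -> bop B ->
  (forall i j, inI I j = true ->
     snd (B (unitvec j) i) = 0 /\ Cmod (T (unitvec j) i) <= fst (B (unitvec j) i)) ->
  gam T <= gam B.
Proof.
  intros HT HB H. apply le_epsilon. intros e He.
  assert (G := gamma_ge0 B HB).
  destruct (gamma_tail B (gam B + e) HB) as [N HN]; [lra|].
  apply (gamma_le_of_tail T N); auto; [lra|].
  apply (tail_op_domination T B N); auto; lra.
Qed.

(** * Compact operators are those of measure zero *)

(** With measure zero in place of compactness the ideal properties follow at once from [gamma_plus]
    and [gamma_comp]. *)
Definition null_op (T : cseq -> cseq) : Prop := bop T /\ gam T = 0.

Lemma null_op_intro T : bop T -> gam T <= 0 -> null_op T.
Proof. intros HT H. split; auto. apply Rle_antisym; auto using gamma_ge0. Qed.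

Lemma null_op_plus S T : null_op S -> null_op T -> null_op (fun x => cadd (S x) (T x)).
Proof.
  intros [HS ZS] [HT ZT]. apply null_op_intro; [auto using bop_plus|].
  assert (P := gamma_plus S T HS HT). lra.
Qed.

Lemma null_op_comp_l S T : bop S -> null_op T -> null_op (fun x => S (T x)).
Proof.
  intros HS [HT ZT]. apply null_op_intro; [auto using bop_comp|].
  assert (P := gamma_comp S T HS HT). rewrite ZT in P. lra.
Qed.

Lemma null_op_comp_r S T : null_op S -> bop T -> null_op (fun x => S (T x)).
Proof.
  intros [HS ZS] HT. apply null_op_intro; [auto using bop_comp|].
  assert (P := gamma_comp S T HS HT). rewrite ZS in P. lra.
Qed.

Lemma null_op_cscale a T : null_op T -> null_op (fun x => cscale a (T x)).
Proof. apply (null_op_comp_l (fun x => cscale a x)). apply bop_cscale, bop_id. Qed.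

Lemma null_op_head N T : bop T -> null_op (fun x => head N (T x)).
Proof. intro HT. apply null_op_intro; auto using bop_head, gamma_head. Qed.

Lemma bop_ext S T : (forall x, L x -> S x = T x) -> bop S -> bop T.
Proof.
  intros H HS. destruct (bop_bound S HS) as (c & _ & Hc).
  apply (bop_intro _ c); intros; rewrite <- !H; auto using L_add, L_scale, bop_L.
  - now apply bop_add.
  - now apply bop_scale.
Qed.

Lemma null_op_ext S T : (forall x, L x -> S x = T x) -> null_op S -> null_op T.
Proof.
  intros H [HS Z]. assert (HT := bop_ext S T H HS). split; auto.
  now rewrite <- (gamma_ext S T).
Qed.

Lemma subseq_ge (phi : nat -> nat) : (forall n, (phi n < phi (S n))%nat) ->
  forall n, (n <= phi n)%nat.
Proof. intros H n. induction n; [lia|]. specialize (H n). lia. Qed.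

(** If gam T > 0, every n has some x_n in the unit ball whose image has n-th tail above gam T / 2. A
    limit y of a subsequence of the images would inherit large tails, against [tail_cv]. *)
Lemma null_op_of_compact T : compact_op L nrm T -> null_op T.
Proof.
  intros [HT H]. apply null_op_intro; auto. apply Rnot_lt_le. intro Hg.
  set (e := gam T / 2).
  assert (Hx : forall n, exists x, L x /\ nrm x <= 1 /\ e < nrm (tail n (T x))).
  { intro n. apply NNPP. intro Hn. assert (gam T <= e); [|unfold e in *; lra].
    apply (gamma_le_of_tail T n); auto; [unfold e; lra|].
    apply (nrm_le_of_ball (fun x => tail n (T x))); auto using bop_tail.
    intros x Hx Hx1. apply Rnot_lt_le. intro. apply Hn. now exists x. }
  set (xs := fun n => proj1_sig (constructive_indefinite_description _ (Hx n))).
  assert (Hxs : forall n, L (xs n) /\ nrm (xs n) <= 1 /\ e < nrm (tail n (T (xs n))))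
    by (intro n; exact (proj2_sig (constructive_indefinite_description _ (Hx n)))).
  destruct (H xs) as (phi & y & Hphi & Hy & Hcv); [intro; split; apply Hxs|].
  destruct (Hcv (e / 2)) as [N HN]; [unfold e; lra|].
  destruct (tail_cv y Hy (e / 2)) as [N' HN']; [unfold e; lra|].
  set (n := max N N'). specialize (HN n (Nat.le_max_l _ _)).
  assert (Hn : (n <= phi n)%nat) by now apply subseq_ge.
  specialize (HN' (phi n)). destruct (Hxs (phi n)) as (X1 & X2 & X3).
  assert (LT := bop_L T _ HT X1).
  replace (T (xs (phi n))) with (cadd (csub (T (xs (phi n))) y) y) in X3 by cseq_ring.
  rewrite tail_add in X3.
  assert (P := nrm_add (tail (phi n) (csub (T (xs (phi n))) y)) (tail (phi n) y)
    (L_tail _ _ (L_sub _ _ LT Hy)) (L_tail _ _ Hy)).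
  assert (Q := nrm_tail (phi n) _ (L_sub _ _ LT Hy)).
  assert (HH : (N' <= phi n)%nat) by (unfold n in *; lia).
  specialize (HN' HH). lra.
Qed.

(** Infinitely many images share one ball of a finite cover of radius e/2. *)
Lemma null_op_refine T (xs : nat -> cseq) (P : nat -> Prop) e : null_op T -> 0 < e ->
  (forall n, L (xs n) /\ nrm (xs n) <= 1) -> infinite P ->
  exists P', infinite P' /\ (forall n, P' n -> P n) /\
    forall p q, P' p -> P' q -> nrm (csub (T (xs p)) (T (xs q))) <= e.
Proof.
  intros [HT Z] He Hxs HP.
  destruct (gamma_cov T (e / 2) HT) as (M & HM & Hc); [lra|].
  destruct (infinite_pigeonhole M P
    (fun y n => L y /\ nrm (csub (T (xs n)) y) <= e / 2)) as (y & Hy & Hinf); auto.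
  - intros n _. destruct (Hc (xs n)) as (y & z & Hy & Hz & Hzn & Heq); try apply Hxs.
    exists y. split; auto. split; [rewrite Forall_forall in HM; auto|].
    replace (csub (T (xs n)) y) with z; auto.
    apply functional_extensionality. intro i. unfold csub. rewrite Heq. ring.
  - eexists. split; [exact Hinf|]. split; [now intros n [? _]|].
    intros p q (_ & Ly & Hp) (_ & _ & Hq).
    assert (Lp : L (T (xs p))) by (apply bop_L; auto; apply Hxs).
    assert (Lq : L (T (xs q))) by (apply bop_L; auto; apply Hxs).
    replace (csub (T (xs p)) (T (xs q)))
      with (csub (csub (T (xs p)) y) (csub (T (xs q)) y)) by cseq_ring.
    eapply Rle_trans; [apply nrm_sub; auto using L_sub|]. lra.
Qed.

Lemma compact_of_null_op T : null_op T -> compact_op L nrm T.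
Proof.
  intros HZ. assert (HT := proj1 HZ). split; auto. intros xs Hxs.
  destruct (diagonal_subsequence
    (fun k p q => nrm (csub (T (xs p)) (T (xs q))) <= / (INR k + 1)))
    as (phi & Hphi & Hd).
  - intros k P HP. apply null_op_refine; auto. apply Rinv_0_lt_compat.
    assert (Q := pos_INR k). lra.
  - destruct (L_complete (fun n => T (xs (phi n)))) as (y & Hy & Hcv).
    + intro n. apply bop_L; auto. apply Hxs.
    + intros eps Heps. destruct (archimed_cor1 eps Heps) as (N & HN & HN0).
      exists N. intros p q Hp Hq. eapply Rle_lt_trans; [now apply (Hd N)|].
      eapply Rle_lt_trans; [|exact HN].
      apply Rinv_le_contravar; [now apply lt_0_INR | lra].
    + exists phi, y. auto.
Qed.

(** * The essential spectrum and [gamma] *)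

(** The inverse comes from the fixed point iteration x -> y + B x. The a priori bound [Hbnd] gives
    uniqueness, and uniqueness gives linearity of the function V obtained by choice. *)
Lemma neumann B q : bop B -> 0 <= q < 1 -> (forall x, L x -> nrm (B x) <= q * nrm x) ->
  exists V, bop V /\
    forall x, L x -> V (csub x (B x)) = x /\ csub (V x) (B (V x)) = x.
Proof.
  intros HB Hq HBq.
  assert (Hbnd : forall x y, L x -> L y -> csub x (B x) = y -> nrm x <= / (1 - q) * nrm y).
  { intros x y Hx Hy Heq. assert (P := HBq x Hx).
    assert (Q : nrm x <= nrm y + nrm (B x)).
    { replace x with (cadd y (B x)) at 1 by (subst y; cseq_ring).
      apply nrm_add; auto using bop_L. }
    apply (Rmult_le_reg_l (1 - q)); [lra|]. rewrite <- Rmult_assoc, Rinv_r; lra. }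
  assert (Huniq : forall x x', L x -> L x' -> csub x (B x) = csub x' (B x') -> x = x').
  { intros x x' Hx Hx' Heq.
    assert (P : csub x x' = czero).
    { apply nrm_eq0; auto using L_sub. apply Rle_antisym; [|auto using nrm_ge0, L_sub].
      replace 0 with (/ (1 - q) * nrm czero) by (rewrite nrm_zero; ring).
      apply Hbnd; auto using L_sub, L_zero.
      rewrite bop_sub by auto.
      replace (csub (csub x x') (csub (B x) (B x')))
        with (csub (csub x (B x)) (csub x' (B x'))) by cseq_ring.
      rewrite Heq. cseq_ring. }
    replace x with (cadd (csub x x') x') by cseq_ring. rewrite P. cseq_ring. }
  (* The premise [L y] stands under the quantifier on x so that choice yields a total function,
     arbitrary outside L. *)
  assert (Hex : forall y, exists x, L y -> L x /\ csub x (B x) = y).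
  { intro y. destruct (classic (L y)) as [Hy|Hy]; [|now exists czero].
    set (xk := fun k => Nat.iter k (fun x => cadd y (B x)) czero).
    assert (Lxk : forall k, L (xk k)).
    { intro k. induction k; simpl; auto using L_zero, L_add, bop_L. }
    assert (Sxk : forall k, xk (S k) = cadd y (B (xk k))) by reflexivity.
    assert (Nxk : forall k, nrm (xk k) <= / (1 - q) * nrm y).
    { intro k. induction k as [|k IH]; simpl.
      - rewrite nrm_zero. apply Rmult_le_pos; [|now apply nrm_ge0].
        apply Rlt_le, Rinv_0_lt_compat. lra.
      - eapply Rle_trans; [apply nrm_add; auto using bop_L|].
        assert (P := HBq (xk k) (Lxk k)).
        assert (Q := Rmult_le_compat_l q _ _ (proj1 Hq) IH).
        apply Rle_trans with (nrm y + q * (/ (1 - q) * nrm y)); [unfold xk in *; lra|].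
        right. field. lra. }
    (* The difference of the iterates k + p and k is B^k applied to the p-th iterate. *)
    assert (Dxk : forall k p, nrm (csub (xk (k + p)%nat) (xk k)) <= q ^ k * (/ (1 - q) * nrm y)).
    { intros k p. induction k as [|k IH].
      - change (csub (xk (0 + p)%nat) (xk 0%nat)) with (csub (xk p) czero).
        replace (csub (xk p) czero) with (xk p) by cseq_ring.
        simpl. specialize (Nxk p). lra.
      - replace (csub (xk (S k + p)%nat) (xk (S k))) with (B (csub (xk (k + p)%nat) (xk k)))
          by (rewrite (bop_sub B) by auto; rewrite ?Nat.add_succ_l, ?Sxk; cseq_ring).
        eapply Rle_trans; [apply HBq; auto using L_sub|].
        simpl. rewrite Rmult_assoc. apply Rmult_le_compat_l; lra. }
    destruct (L_complete xk Lxk) as (x & Hx & Hcv).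
    - intros eps Heps. set (K := / (1 - q) * nrm y) in *.
      assert (K0 : 0 <= K) by (specialize (Nxk 0%nat); simpl in Nxk; rewrite nrm_zero in Nxk; exact Nxk).
      destruct (pow_lt_1_zero q) with (y := eps / (2 * (K + 1))) as [N HN].
      + rewrite Rabs_pos_eq; lra.
      + apply Rdiv_lt_0_compat; lra.
      + exists N. intros p p' Hp Hp'.
        assert (Hb : forall r, (N <= r)%nat -> nrm (csub (xk r) (xk N)) < eps / 2).
        { intros r Hr. replace r with (N + (r - N))%nat by lia.
          eapply Rle_lt_trans; [apply Dxk|]. specialize (HN N (Nat.le_refl N)).
          apply Rle_lt_trans with (q ^ N * (K + 1)).
          - apply Rmult_le_compat_l; [apply pow_le; lra | lra].
          - assert (P := Rle_abs (q ^ N)).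
            apply Rlt_le_trans with (eps / (2 * (K + 1)) * (K + 1)).
            + apply Rmult_lt_compat_r; lra.
            + right. field. lra. }
        replace (csub (xk p) (xk p'))
          with (csub (csub (xk p) (xk N)) (csub (xk p') (xk N))) by cseq_ring.
        eapply Rle_lt_trans; [apply nrm_sub; auto using L_sub|].
        assert (P := Hb p Hp). assert (Q := Hb p' Hp'). lra.
    - exists x. intros _. split; auto.
      replace (csub x (B x)) with (cadd y (csub (csub x (B x)) y)) by cseq_ring.
      replace (csub (csub x (B x)) y) with czero; [cseq_ring|].
      symmetry. apply nrm_eq0; auto using L_sub, bop_L.
      apply Rle_antisym; [|auto using nrm_ge0, L_sub, bop_L].
      apply Rnot_lt_le. intro Hpos.
      set (d := nrm (csub (csub x (B x)) y)) in *.
      destruct (Hcv (d / 2)) as [N HN]; [lra|].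
      assert (P1 := HN N (Nat.le_refl N)). assert (P2 := HN (S N) (Nat.le_succ_diag_r N)).
      assert (d <= nrm (csub (xk N) x) + nrm (csub (xk (S N)) x)); [|lra].
      unfold d.
      (* Since x_(N+1) = y + B x_N, the defect x - B x - y is expressed by the errors of two
         consecutive iterates. *)
      replace (csub (csub x (B x)) y)
        with (csub (B (csub (xk N) x)) (csub (xk (S N)) x))
        by (rewrite (bop_sub B) by auto; rewrite ?Nat.add_succ_l, ?Sxk; cseq_ring).
      eapply Rle_trans; [apply nrm_sub; auto using L_sub, bop_L|].
      apply Rplus_le_compat_r. eapply Rle_trans; [apply HBq; auto using L_sub|].
      assert (P := nrm_ge0 _ (L_sub _ _ (Lxk N) Hx)). nra. }
  set (V := fun y => proj1_sig (constructive_indefinite_description _ (Hex y))).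
  assert (HV : forall y, L y -> L (V y) /\ csub (V y) (B (V y)) = y)
    by (intro y; exact (proj2_sig (constructive_indefinite_description _ (Hex y)))).
  exists V. split.
  - apply (bop_intro _ (/ (1 - q))).
    + apply HV.
    + intros x y Hx Hy. destruct (HV x Hx) as [X1 X2]. destruct (HV y Hy) as [Y1 Y2].
      destruct (HV _ (L_add x y Hx Hy)) as [Z1 Z2].
      apply Huniq; auto using L_add. rewrite Z2, (bop_add B) by auto.
      rewrite <- X2, <- Y2 at 1. cseq_ring.
    + intros a x Hx. destruct (HV x Hx) as [X1 X2].
      destruct (HV _ (L_scale a x Hx)) as [Z1 Z2].
      apply Huniq; auto using L_scale. rewrite Z2, (bop_scale B) by auto.
      rewrite <- X2 at 1. cseq_ring.
    + intros x Hx. destruct (HV x Hx) as [X1 X2]. now apply Hbnd.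
  - intros x Hx. destruct (HV x Hx) as [X1 X2]. split; auto.
    destruct (HV (csub x (B x))) as [Y1 Y2]; auto using L_sub, bop_L.
Qed.

(** Up to a finite rank head, X is its own tail, whose norm is below 1 for large N; the Neumann
    inverse of 1 minus that tail is the desired W. *)
Lemma inverse_mod_null X : bop X -> gam X < 1 ->
  exists W, bop W /\ null_op (fun x => csub (W (csub x (X x))) x) /\
    null_op (fun x => csub (csub (W x) (X (W x))) x).
Proof.
  intros HX H1. assert (G := gamma_ge0 X HX).
  destruct (gamma_tail X ((gam X + 1) / 2) HX) as [N HN]; [lra|].
  destruct (neumann (fun x => tail N (X x)) ((gam X + 1) / 2)) as (W & HW & HV);
    [auto using bop_tail | lra | auto|].
  exists W. split; auto. split.
  - apply (null_op_ext (fun x => cscale (Copp (RtoC 1)) (W (head N (X x))))).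
    + intros x Hx. destruct (HV x Hx) as [E _].
      replace (csub x (X x)) with (csub (csub x (tail N (X x))) (head N (X x))).
      * rewrite (bop_sub W), E by auto using L_sub, L_tail, L_head, bop_L. cseq_ring.
      * generalize (head_add_tail N (X x)).
        generalize (head N (X x)) (tail N (X x)). intros h t <-. cseq_ring.
    + apply null_op_cscale, null_op_comp_l, null_op_head; auto.
  - apply (null_op_ext (fun x => cscale (Copp (RtoC 1)) (head N (X (W x))))).
    + intros x Hx. destruct (HV x Hx) as [_ E].
      revert E. generalize (head_add_tail N (X (W x))).
      generalize (head N (X (W x))) (tail N (X (W x))). intros h t <- E.
      rewrite <- E at 2. cseq_ring.
    + apply null_op_cscale. apply (null_op_head N (fun x => X (W x))). now apply bop_comp.
Qed.

Lemma geometric_right Y n x : bop Y -> L x ->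
  csub (vsum n (fun k => Nat.iter k Y x)) (Y (vsum n (fun k => Nat.iter k Y x)))
  = csub x (Nat.iter n Y x).
Proof.
  intros HY Hx. induction n as [|n IH]; simpl.
  - rewrite bop_zero by auto. cseq_ring.
  - assert (L1 : L (vsum n (fun k => Nat.iter k Y x))).
    { apply L_vsum. intros. apply bop_L; auto using bop_iter. }
    assert (L2 : L (Nat.iter n Y x)) by (apply bop_L; auto using bop_iter).
    rewrite (bop_add Y) by auto.
    replace (csub x (Y (Nat.iter n Y x)))
      with (cadd (csub x (Nat.iter n Y x)) (csub (Nat.iter n Y x) (Y (Nat.iter n Y x))))
      by cseq_ring.
    rewrite <- IH. cseq_ring.
Qed.

Lemma geometric_left Y n x : bop Y -> L x ->
  vsum n (fun k => Nat.iter k Y (csub x (Y x))) = csub x (Nat.iter n Y x).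
Proof.
  intros HY Hx. induction n as [|n IH]; simpl; [cseq_ring|].
  rewrite IH, (bop_sub (Nat.iter n Y)), <- Nat.iter_succ_r
    by auto using bop_iter, bop_L.
  simpl. cseq_ring.
Qed.

Lemma iter_cscale T a n x : bop T -> L x ->
  Nat.iter n (fun y => cscale a (T y)) x = cscale (Cpow a n) (Nat.iter n T x).
Proof.
  intros HT Hx. induction n as [|n IH]; simpl; [cseq_ring|].
  rewrite IH, (bop_scale T) by auto using bop_L, bop_iter. cseq_ring.
Qed.

Lemma Cmod_pow a n : Cmod (Cpow a n) = Cmod a ^ n.
Proof.
  induction n as [|n IH]; simpl; [apply Cmod_1|]. now rewrite Cmod_mult, IH.
Qed.

(** With Y = T / lam and Q the sum of Y^k for k < n, both Q (1 - Y) and (1 - Y) Q equal 1 - Y^n. As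
    gamma(Y^n) < 1, this has an inverse W modulo measure zero, and Q W inverts 1 - Y. *)
Lemma not_ess_spectrum T lam n : bop T -> lam <> RtoC 0 ->
  gam (Nat.iter n T) < Cmod lam ^ n -> ~ ess_spectrum L nrm T lam.
Proof.
  intros HT Hlam Hg Hess. apply Hess. clear Hess.
  assert (Hl0 : 0 < Cmod lam) by now apply Cmod_gt_0.
  set (Y := fun x => cscale (Cinv lam) (T x)).
  assert (HY : bop Y) by now apply bop_cscale.
  destruct (inverse_mod_null (Nat.iter n Y)) as (W & HW & HWl & HWr);
    [auto using bop_iter| |].
  { rewrite (gamma_ext _ (fun x => cscale (Cpow (Cinv lam) n) (Nat.iter n T x)));
      [ | intros; now apply iter_cscale | auto using bop_iter
        | auto using bop_cscale, bop_iter].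
    eapply Rle_lt_trans; [apply gamma_cscale; auto using bop_iter|].
    rewrite Cmod_pow, Cmod_inv, pow_inv by auto.
    assert (P : 0 < Cmod lam ^ n) by now apply pow_lt.
    apply (Rmult_lt_reg_l (Cmod lam ^ n)); auto.
    rewrite <- Rmult_assoc, Rinv_r; lra. }
  set (Q := fun x => vsum n (fun k => Nat.iter k Y x)).
  assert (HQ : bop Q) by (apply bop_vsum; auto using bop_iter).
  set (u := fun x => csub x (Y x)).
  assert (Hu : bop u) by (apply bop_minus; auto using bop_id).
  set (E1 := fun x => csub (W (Q (u x))) x).
  set (E2 := fun x => csub (u (Q (W x))) x).
  assert (N1 : null_op E1).
  { eapply null_op_ext; [|exact HWl]. intros x Hx. unfold E1, Q, u; cbv beta.
    now rewrite geometric_left. }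
  assert (N2 : null_op E2).
  { eapply null_op_ext; [|exact HWr]. intros x Hx. unfold E2, Q, u; cbv beta.
    rewrite geometric_right; auto using bop_L. }
  set (Ri := fun x => Q (W x)).
  assert (HR : bop Ri) by exact (bop_comp Q W HQ HW).
  (* a right inverse is also a left one: with W Q u = 1 + E1 and u Ri = 1 + E2,
     Ri u - 1 = W Q E2 u - E1 Ri u + E1 *)
  assert (N3 : null_op (fun x => csub (Ri (u x)) x)).
  { apply (null_op_ext (fun x => cadd (cadd (cscale (Copp (RtoC 1)) (E1 (Ri (u x))))
      (W (Q (E2 (u x))))) (E1 x))).
    - intros x Hx. unfold E1, E2. fold (Ri (u x)).
      rewrite (bop_sub Q), (bop_sub W) by auto using bop_L. cseq_ring.
    - apply null_op_plus; auto. apply null_op_plus.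
      + apply null_op_cscale. apply (null_op_comp_r E1 (fun x => Ri (u x))); auto.
        exact (bop_comp Ri u HR Hu).
      + apply (null_op_comp_l (fun x => W (Q x)) (fun x => E2 (u x)));
          [exact (bop_comp W Q HW HQ)|]. now apply null_op_comp_r. }
  assert (Hil : Cmult lam (Cinv lam) = RtoC 1) by now apply Cinv_r.
  assert (HTl : forall x, csub (T x) (cscale lam x) = cscale (Copp lam) (u x)).
  { intro x. unfold u, Y. apply functional_extensionality. intro i.
    unfold csub, cscale.
    transitivity (Cminus (Cmult (Cmult lam (Cinv lam)) (T x i)) (Cmult lam (x i)));
      [rewrite Hil; ring | ring]. }
  exists (fun x => cscale (Copp (Cinv lam)) (Ri x)).
  split; [now apply bop_cscale|].
  assert (Hcc : forall y, cscale (Copp lam) (cscale (Copp (Cinv lam)) y) = y).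
  { intro y. apply functional_extensionality. intro i. unfold cscale.
    transitivity (Cmult (Cmult lam (Cinv lam)) (y i)); [ring | rewrite Hil; ring]. }
  split; apply compact_of_null_op.
  - apply (null_op_ext E2); auto. intros x Hx. unfold E2. rewrite HTl.
    rewrite (bop_scale u) by auto using bop_L. now rewrite Hcc.
  - eapply null_op_ext; [|exact N3]. intros x Hx. cbv beta. rewrite HTl.
    rewrite (bop_scale Ri) by auto using bop_L.
    replace (cscale (Copp (Cinv lam)) (cscale (Copp lam) (Ri (u x)))) with (Ri (u x)); auto.
    rewrite <- (Hcc (Ri (u x))) at 1. cseq_ring.
Qed.

Lemma ess_spectrum_le_gamma T lam n : bop T -> ess_spectrum L nrm T lam ->
  Cmod lam ^ n <= gam (Nat.iter n T).
Proof.
  intros HT Hess. assert (G := gamma_ge0 _ (bop_iter n T HT)).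
  destruct (Rle_lt_dec (Cmod lam ^ n) (gam (Nat.iter n T))) as [H|H]; auto.
  destruct (classic (lam = RtoC 0)) as [->|Hl].
  (* For n = 0 the assumption reads gam(identity) < 1. Then gam S <= gam S * gam(identity) makes
     every measure vanish, so the Calkin algebra is trivial and nothing lies in the essential
     spectrum. *)
  - destruct n as [|n]; [|rewrite Cmod_0, pow_i in H by lia; lra].
    exfalso. apply Hess.
    exists (fun x => x). split; [exact bop_id|].
    assert (Hall : forall S, bop S -> null_op S).
    { intros S HS. apply null_op_intro; auto. apply Rnot_lt_le. intro Hp.
      assert (P := gamma_comp S (fun x => x) HS bop_id).
      assert (H' : gam (fun x => x) < 1) by exact H.
      assert (P' : gam S <= gam S * gam (fun x => x)) by exact P. nra. }
    split; apply compact_of_null_op, Hall;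
      repeat (apply bop_minus || apply bop_cscale); auto using bop_id.
  - exfalso. now apply (not_ess_spectrum T lam n).
Qed.

(** The set under the supremum contains 0 and, by [ess_spectrum_le_gamma] with n = 1, is bounded by
    gam T; so the supremum is finite and [real] keeps its value. *)
Lemma rho_ess_spec T : bop T -> 0 <= rho_ess L nrm T /\
  (forall lam, ess_spectrum L nrm T lam -> Cmod lam <= rho_ess L nrm T) /\
  (forall c, 0 <= c -> (forall lam, ess_spectrum L nrm T lam -> Cmod lam <= c) ->
    rho_ess L nrm T <= c).
Proof.
  intro HT. unfold rho_ess. set (E := fun r => r = 0 \/ _).
  destruct (Lub_Rbar_correct E) as [Hub Hlub].
  assert (H0 : Rbar_le 0 (Lub_Rbar E)) by (apply Hub; now left).
  assert (Hc : forall c, 0 <= c -> (forall lam, ess_spectrum L nrm T lam -> Cmod lam <= c) ->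
    Rbar_le (Lub_Rbar E) c).
  { intros c Hc H. apply Hlub. intros r [->|(lam & Hlam & ->)]; simpl; auto. }
  assert (H1 := Hc (gam T) (gamma_ge0 T HT)).
  assert (H2 : forall lam, ess_spectrum L nrm T lam -> Rbar_le (Cmod lam) (Lub_Rbar E)).
  { intros lam Hlam. apply Hub. right. now exists lam. }
  destruct (Lub_Rbar E) as [l| |]; simpl in *; try easy.
  - auto.
  - exfalso. apply H1. intros lam Hlam.
    assert (P := ess_spectrum_le_gamma T lam 1 HT Hlam).
    simpl in P. rewrite Rmult_1_r in P. exact P.
Qed.

(** * Positive operators *)

Notation pos := (positive_op L nrm).

Lemma positive_entry T i j : pos T -> inI I j = true ->
  0 <= fst (T (unitvec j) i) /\ snd (T (unitvec j) i) = 0.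
Proof.
  intros [_ HT] Hj. apply HT; [now apply L_unitvec | apply unitvec_nonneg].
Qed.

Lemma positive_iter T n : pos T -> pos (Nat.iter n T).
Proof.
  intros [HT HP]. split; [now apply bop_iter|].
  intros x Hx Hn. induction n as [|n IH]; simpl; auto.
  apply HP; auto. apply bop_L; auto using bop_iter.
Qed.

Lemma positive_le T x y : pos T -> L x -> L y -> nonnegseq x -> nonnegseq y ->
  (forall i, fst (x i) <= fst (y i)) -> forall i, fst (T x i) <= fst (T y i).
Proof.
  intros [HT HP] Hx Hy Nx Ny Hle i.
  assert (P : nonnegseq (T (csub y x))).
  { apply HP; auto using L_sub. intro k. unfold csub. simpl.
    destruct (Nx k) as [_ ->], (Ny k) as [_ ->]. specialize (Hle k). split; lra. }
  rewrite (bop_sub T) in P by auto. destruct (P i) as [Q _]. unfold csub in Q.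
  simpl in Q. lra.
Qed.

Lemma vsum_nonneg m F : (forall k, (k < m)%nat -> nonnegseq (F k)) -> nonnegseq (vsum m F).
Proof.
  induction m as [|m IH]; simpl; intros H i; [simpl; lra|].
  destruct (IH (fun k Hk => H k (Nat.lt_lt_succ_r _ _ Hk)) i) as [A1 A2].
  destruct (H m (Nat.lt_succ_diag_r m) i) as [B1 B2].
  unfold cadd. simpl. rewrite A2, B2. split; lra.
Qed.

Lemma vsum_ge m F i k t : (forall l, (l < m)%nat -> nonnegseq (F l)) -> (k <= m)%nat ->
  (forall l, (l < k)%nat -> t <= fst (F l i)) -> INR k * t <= fst (vsum m F i).
Proof.
  intros H Hk Ht.
  assert (H0 : INR k * t <= fst (vsum k F i)).
  { clear H Hk. induction k as [|k IH]; [simpl; lra|].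
    rewrite S_INR. simpl. unfold cadd. simpl. specialize (Ht k (Nat.lt_succ_diag_r k)) as P.
    assert (Q := IH (fun l Hl => Ht l (Nat.lt_lt_succ_r _ _ Hl))). lra. }
  induction Hk as [|m Hk IH]; auto. simpl. unfold cadd. simpl.
  destruct (H m (Nat.lt_succ_diag_r m) i) as [B _].
  assert (Q := IH (fun l Hl => H l (Nat.lt_lt_succ_r _ _ Hl))). lra.
Qed.

Lemma vsum_ge_term m F i k : (forall l, (l < m)%nat -> nonnegseq (F l)) -> (k < m)%nat ->
  fst (F k i) <= fst (vsum m F i).
Proof.
  induction m as [|m IH]; intros H Hk; [lia|]. simpl. unfold cadd. simpl.
  assert (Hm := fun l Hl => H l (Nat.lt_lt_succ_r l m Hl)).
  destruct (H m (Nat.lt_succ_diag_r m) i) as [P _].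
  destruct (vsum_nonneg m F Hm i) as [Q _].
  destruct (Nat.eq_dec k m) as [->|Hne]; [lra|].
  assert (P' : fst (F k i) <= fst (vsum m F i)) by (apply IH; auto; lia). lra.
Qed.

(** * Truncated resolvents and the essential spectral radius of a positive operator *)

Section Resolvent.

Context (A : cseq -> cseq) (HA : pos A).

(** The first m terms of the Neumann series of (lam - A)^(-1). *)
Definition partial_resolvent (lam : R) (m : nat) (x : cseq) : cseq :=
  vsum m (fun l => cscale (RtoC ((/ lam) ^ S l)) (Nat.iter l A x)).

Lemma bop_partial_resolvent lam m : bop (partial_resolvent lam m).
Proof.
  apply (bop_vsum m (fun l x => cscale (RtoC ((/ lam) ^ S l)) (Nat.iter l A x))).
  intros. apply bop_cscale, bop_iter, HA.
Qed.

Lemma partial_resolvent_spec lam m x : 0 < lam -> L x ->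
  csub (cscale (RtoC lam) (partial_resolvent lam m x)) (A (partial_resolvent lam m x))
  = csub x (cscale (RtoC ((/ lam) ^ m)) (Nat.iter m A x)).
Proof.
  intros Hl Hx. assert (HB := proj1 HA). induction m as [|m IH].
  - change (partial_resolvent lam 0 x) with czero.
    rewrite (bop_zero A) by auto. simpl. cseq_ring.
  - change (partial_resolvent lam (S m) x)
      with (cadd (partial_resolvent lam m x) (cscale (RtoC ((/ lam) ^ S m)) (Nat.iter m A x))).
    assert (Lm : L (Nat.iter m A x)) by (apply bop_L; auto using bop_iter).
    rewrite (bop_add A), (bop_scale A) by
      (auto using L_scale; apply bop_L; auto using bop_partial_resolvent).
    change (Nat.iter (S m) A x) with (A (Nat.iter m A x)).
    assert (E : Cmult (RtoC lam) (RtoC ((/ lam) ^ S m)) = RtoC ((/ lam) ^ m)).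
    { rewrite <- RtoC_mult. f_equal. simpl. field. lra. }
    apply functional_extensionality. intro i.
    apply (f_equal (fun v => v i)) in IH. revert IH. unfold csub, cadd, cscale.
    intro IH.
    transitivity (Cplus (Cminus (Cmult (RtoC lam) (partial_resolvent lam m x i))
        (A (partial_resolvent lam m x) i))
      (Cminus (Cmult (Cmult (RtoC lam) (RtoC ((/ lam) ^ S m))) (Nat.iter m A x i))
        (Cmult (RtoC ((/ lam) ^ S m)) (A (Nat.iter m A x) i)))); [ring|].
    rewrite IH, E. ring.
Qed.

Lemma nonneg_scale r x : 0 <= r -> nonnegseq x -> nonnegseq (cscale (RtoC r) x).
Proof.
  intros Hr Hx i. destruct (Hx i) as [P Q]. unfold cscale. simpl. rewrite Q. split; nra.
Qed.

Lemma partial_resolvent_terms lam m x : 0 < lam -> L x -> nonnegseq x ->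
  forall l, (l < m)%nat -> nonnegseq (cscale (RtoC ((/ lam) ^ S l)) (Nat.iter l A x)).
Proof.
  intros Hl Hx Nx l _. apply nonneg_scale.
  - apply pow_le, Rlt_le, Rinv_0_lt_compat, Hl.
  - now apply (positive_iter A l HA).
Qed.

(* All [n+1] pairs [(l, n-l)] contribute [A^n / lam^(n+2)] to the square. *)
Lemma partial_resolvent_square lam m n x i : 0 < lam -> (n < m)%nat -> L x -> nonnegseq x ->
  INR (S n) * ((/ lam) ^ (n + 2) * fst (Nat.iter n A x i)) <=
  fst (partial_resolvent lam m (partial_resolvent lam m x) i).
Proof.
  intros Hl Hn Hx Nx. assert (HB := proj1 HA).
  set (y := partial_resolvent lam m x).
  assert (Ly : L y) by (apply bop_L; auto using bop_partial_resolvent).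
  assert (Ny : nonnegseq y) by exact (vsum_nonneg m _ (partial_resolvent_terms lam m x Hl Hx Nx)).
  unfold partial_resolvent. apply vsum_ge; [exact (partial_resolvent_terms lam m y Hl Ly Ny) | lia|].
  intros l Hln.
  assert (Hi : 0 < / lam) by now apply Rinv_0_lt_compat.
  set (z := cscale (RtoC ((/ lam) ^ S (n - l))) (Nat.iter (n - l) A x)).
  assert (Lz : L z) by (apply L_scale, bop_L; auto using bop_iter).
  assert (Nz : nonnegseq z).
  { apply nonneg_scale; [apply pow_le; lra | now apply (positive_iter A (n - l) HA)]. }
  assert (Hzy : forall k, fst (z k) <= fst (y k)).
  { intro k.
    exact (vsum_ge_term m _ k (n - l) (partial_resolvent_terms lam m x Hl Hx Nx) ltac:(lia)). }
  assert (P := positive_le (Nat.iter l A) z y (positive_iter A l HA) Lz Ly Nz Ny Hzy i).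
  unfold z in P. rewrite (bop_scale (Nat.iter l A)) in P by auto using bop_iter, bop_L.
  rewrite <- Nat.iter_add in P. replace (l + (n - l))%nat with n in P by lia.
  rewrite fst_cscale_R in P |- *.
  replace (n + 2)%nat with (S l + S (n - l))%nat by lia.
  rewrite pow_add, Rmult_assoc. apply Rmult_le_compat_l; [apply pow_le; lra | exact P].
Qed.

Lemma gamma_power_le_partial_resolvent lam m n : 0 < lam -> (n < m)%nat ->
  INR (S n) * (/ lam) ^ (n + 2) * gam (Nat.iter n A) <=
  gam (partial_resolvent lam m) * gam (partial_resolvent lam m).
Proof.
  intros Hl Hn. assert (HB := proj1 HA).
  assert (BS := bop_partial_resolvent lam m).
  assert (Hi : 0 < / lam) by now apply Rinv_0_lt_compat.
  set (c := INR (S n) * (/ lam) ^ (n + 2)).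
  assert (Hc : 0 < c).
  { apply Rmult_lt_0_compat; [apply lt_0_INR; lia | now apply pow_lt]. }
  apply Rle_trans with (gam (fun x => cscale (RtoC c) (Nat.iter n A x))).
  (* [gamma_cscale] is only an upper bound; applied to the factor 1/c it gives c gam(A^n) <= gam(c
     A^n). *)
  - rewrite (gamma_ext (Nat.iter n A)
      (fun x => cscale (RtoC (/ c)) (cscale (RtoC c) (Nat.iter n A x)))).
    + assert (P := gamma_cscale (RtoC (/ c)) (fun x => cscale (RtoC c) (Nat.iter n A x))).
      rewrite Cmod_R, Rabs_pos_eq in P by (apply Rlt_le, Rinv_0_lt_compat, Hc).
      assert (Q := P (bop_cscale _ _ (bop_iter n A HB))).
      apply (Rmult_le_compat_l c) in Q; [|lra].
      rewrite <- Rmult_assoc, Rinv_r, Rmult_1_l in Q by lra. exact Q.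
    + intros x Hx. apply functional_extensionality. intro i. unfold cscale.
      rewrite Cmult_assoc, <- RtoC_mult, Rinv_l by lra. ring.
    + now apply bop_iter.
    + apply bop_cscale, bop_cscale, bop_iter, HB.
  - eapply Rle_trans; [|apply gamma_comp; exact BS].
    apply gamma_mono; [apply bop_cscale, bop_iter, HB | now apply bop_comp|].
    intros i j Hj. destruct (L_unitvec j Hj) as [Lu _].
    assert (P := partial_resolvent_square lam m n _ i Hl Hn Lu (unitvec_nonneg j)).
    assert (PS : forall x, L x -> nonnegseq x -> nonnegseq (partial_resolvent lam m x))
      by (intros x Hx Nx; exact (vsum_nonneg m _ (partial_resolvent_terms lam m x Hl Hx Nx))).
    split.
    + apply PS; auto using unitvec_nonneg. apply (bop_L _ _ BS Lu).
    + destruct (positive_entry _ i j (positive_iter A n HA) Hj) as [E1 E2].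
      unfold cscale. rewrite Cmod_mult, Cmod_R, Rabs_pos_eq, Cmod_real_nonneg by (auto; lra).
      unfold c. rewrite Rmult_assoc. exact P.
Qed.

(** The remainder e has measure at most 1, and moving from rho to lam costs at most half of gam S;
    so gam S <= 2 gam b + gam S / 2. *)
Lemma partial_resolvent_gamma b rho lam m : 0 < lam -> bop b ->
  null_op (fun x => csub (b (csub (cscale (RtoC rho) x) (A x))) x) ->
  rho <= lam -> (lam - rho) * gam b <= / 2 -> gam (Nat.iter m A) <= lam ^ m ->
  gam (partial_resolvent lam m) <= 4 * gam b.
Proof.
  intros Hl Hb HN Hrho Hsmall Hm. assert (HB := proj1 HA).
  set (S := partial_resolvent lam m). assert (BS : bop S) by apply bop_partial_resolvent.
  set (e := fun x => cscale (RtoC ((/ lam) ^ m)) (Nat.iter m A x)).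
  assert (Be : bop e) by apply bop_cscale, bop_iter, HB.
  assert (Hi : 0 < / lam) by now apply Rinv_0_lt_compat.
  assert (Ge : gam e <= 1).
  { eapply Rle_trans; [apply gamma_cscale, bop_iter, HB|].
    rewrite Cmod_R, Rabs_pos_eq, pow_inv by (apply pow_le; lra).
    assert (P : 0 < lam ^ m) by now apply pow_lt.
    apply (Rmult_le_reg_l (lam ^ m)); auto. rewrite <- Rmult_assoc, Rinv_r; lra. }
  set (E := fun x => csub (b (csub (cscale (RtoC rho) x) (A x))) x).
  assert (BE : bop E) by exact (proj1 HN).
  (* b (rho - A) S = b (1 - e) - (lam - rho) b S *)
  assert (HS : forall x, L x -> S x = csub (csub (csub (b x) (b (e x)))
      (cscale (RtoC (lam - rho)) (b (S x)))) (E (S x))).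
  { intros x Hx. assert (LS := bop_L S x BS Hx). unfold E.
    assert (P := partial_resolvent_spec lam m x Hl Hx). fold (e x) in P. fold S in P.
    replace (csub (cscale (RtoC rho) (S x)) (A (S x)))
      with (csub (csub x (e x)) (cscale (RtoC (lam - rho)) (S x))).
    - rewrite (bop_sub b (csub x (e x))), (bop_sub b x), (bop_scale b)
        by auto using L_sub, L_scale, bop_L.
      cseq_ring.
    - rewrite <- P. apply functional_extensionality. intro i. unfold csub, cscale.
      rewrite RtoC_minus. ring. }
  assert (B1 : bop (fun x => b (e x))) by now apply bop_comp.
  assert (B2 : bop (fun x => cscale (RtoC (lam - rho)) (b (S x))))
    by (apply bop_cscale; now apply bop_comp).
  assert (B3 : bop (fun x => E (S x))) by now apply bop_comp.
  assert (Q1 := gamma_minus _ _ Hb B1).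
  assert (B4 := bop_minus _ _ Hb B1).
  assert (Q2 := gamma_minus _ _ B4 B2).
  assert (B5 := bop_minus _ _ B4 B2).
  assert (Q3 := gamma_minus _ _ B5 B3).
  assert (B6 := bop_minus _ _ B5 B3).
  cbv beta in Q2, Q3. rewrite <- (gamma_ext S _ HS BS B6) in Q3.
  assert (P1 := gamma_comp b e Hb Be).
  assert (P2 := gamma_cscale (RtoC (lam - rho)) _ (bop_comp b S Hb BS)).
  rewrite Cmod_R, Rabs_pos_eq in P2 by lra.
  assert (P3 := gamma_comp b S Hb BS).
  assert (P4 := gamma_comp E S BE BS). assert (ZE : gam E = 0) by exact (proj2 HN).
  rewrite ZE, Rmult_0_l in P4.
  assert (G1 := gamma_ge0 b Hb). assert (G2 := gamma_ge0 S BS). assert (G3 := gamma_ge0 e Be).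
  assert (P5 : (lam - rho) * gam (fun x => b (S x)) <= / 2 * gam S).
  { apply Rle_trans with ((lam - rho) * (gam b * gam S)); [apply Rmult_le_compat_l; lra|].
    rewrite <- Rmult_assoc. apply Rmult_le_compat_r; lra. }
  assert (P6 : gam b * gam e <= gam b * 1) by (apply Rmult_le_compat_l; lra).
  lra.
Qed.

(** Analogue for the essential spectrum of the fact that the spectral radius of a positive operator
    is a spectral value. The choices come in the order n, lam, m: n exceeds a constant given by the
    inverse, lam is close to rho depending on n, and m depends on both. *)
Lemma ess_spectrum_of_growth rho : 0 < rho ->
  (forall n, (1 <= n)%nat -> rho ^ n <= gam (Nat.iter n A)) ->
  (forall mu, rho < mu -> exists n, (1 <= n)%nat /\ gam (Nat.iter n A) < mu ^ n) ->
  ess_spectrum L nrm A (RtoC rho).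
Proof.
  intros Hrho Hlow Hup (V & HV & _ & Hcomp). assert (HB := proj1 HA).
  set (b := fun x => cscale (Copp (RtoC 1)) (V x)).
  assert (Hb : bop b) by now apply bop_cscale.
  assert (HN : null_op (fun x => csub (b (csub (cscale (RtoC rho) x) (A x))) x)).
  { apply (null_op_ext (fun x => csub (V (csub (A x) (cscale (RtoC rho) x))) x));
      [|now apply null_op_of_compact].
    intros x Hx. unfold b. rewrite !(bop_sub V) by (auto using L_scale, bop_L). cseq_ring. }
  assert (G := gamma_ge0 b Hb).
  (* The final inequality reads (n + 1) / (2 rho^2) <= (4 gam b)^2, that is, n + 1 <= 32 (gam b)^2
     rho^2. *)
  destruct (INR_unbounded (32 * (gam b * gam b) * (rho * rho))) as [n0 Hn0].
  set (n := S n0).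
  (* The bound on t makes (lam - rho) gam b <= 1/2, and (1 + t)^(n+2) <= 2 keeps rho^n / lam^(n+2)
     above 1 / (2 rho^2). *)
  destruct (small_growth (n + 2) (/ (2 * rho * (gam b + 1)))) as (t & Ht0 & Ht1 & Ht2).
  { apply Rinv_0_lt_compat. repeat apply Rmult_lt_0_compat; lra. }
  set (lam := rho * (1 + t)).
  assert (Hlr : lam - rho = rho * t) by (unfold lam; ring).
  assert (Hrt : 0 < rho * t) by now apply Rmult_lt_0_compat.
  destruct (Hup lam) as (k & Hk1 & Hk); [lra|].
  (* The number of terms is a multiple of k, so that the estimate for A^k passes to it, and it
     exceeds n. *)
  assert (Hm : gam (Nat.iter (k * S n) A) <= lam ^ (k * S n)).
  { rewrite iter_mul, pow_mult. eapply Rle_trans; [apply gamma_iter, bop_iter, HB|].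
    apply pow_incr. split; [apply gamma_ge0, bop_iter, HB | lra]. }
  assert (P := partial_resolvent_gamma b rho lam (k * S n) ltac:(lra) Hb HN ltac:(lra)).
  assert (Hsm : (lam - rho) * gam b <= / 2).
  { rewrite Hlr. apply Rle_trans with (rho * t * (gam b + 1)); [nra|].
    apply (Rmult_le_compat_r (rho * (gam b + 1))) in Ht1;
      [|apply Rlt_le, Rmult_lt_0_compat; lra].
    replace (/ (2 * rho * (gam b + 1)) * (rho * (gam b + 1))) with (/ 2) in Ht1
      by (field; lra). lra. }
  specialize (P Hsm Hm).
  assert (Hnm : (n < k * S n)%nat) by nia.
  assert (Q := gamma_power_le_partial_resolvent lam (k * S n) n ltac:(lra) Hnm).
  set (g := gam (partial_resolvent lam (k * S n))) in *.
  assert (Hg : 0 <= g) by apply gamma_ge0, bop_partial_resolvent.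
  assert (Hlow' := Hlow n ltac:(unfold n; lia)).
  assert (Hq : g * g <= 16 * (gam b * gam b)).
  { replace (16 * (gam b * gam b)) with ((4 * gam b) * (4 * gam b)) by ring.
    apply Rmult_le_compat; auto. }
  assert (Hpw : / (2 * (rho * rho)) <= (/ lam) ^ (n + 2) * rho ^ n).
  { unfold lam. rewrite pow_inv, Rpow_mult_distr, (pow_add rho n 2).
    assert (R1 : 0 < rho ^ n) by now apply pow_lt.
    assert (R2 : 0 < (1 + t) ^ (n + 2)) by (apply pow_lt; lra).
    replace (/ (rho ^ n * rho ^ 2 * (1 + t) ^ (n + 2)) * rho ^ n)
      with (/ ((1 + t) ^ (n + 2) * (rho * rho))) by (field; repeat split; lra).
    apply Rinv_le_contravar; [apply Rmult_lt_0_compat; [exact R2 | nra]|].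
    apply Rmult_le_compat_r; [nra | exact Ht2]. }
  assert (Hpos : 0 <= (/ lam) ^ (n + 2)) by (apply pow_le, Rlt_le, Rinv_0_lt_compat; lra).
  assert (Hfin : INR (S n) * / (2 * (rho * rho)) <= 16 * (gam b * gam b)).
  { eapply Rle_trans; [|exact Hq]. eapply Rle_trans; [|exact Q]. rewrite Rmult_assoc.
    apply Rmult_le_compat_l; [apply pos_INR|].
    eapply Rle_trans; [exact Hpw|]. apply Rmult_le_compat_l; auto. }
  assert (R2 : 0 < rho * rho) by now apply Rmult_lt_0_compat.
  apply (Rmult_le_compat_r (2 * (rho * rho))) in Hfin; [|lra].
  rewrite Rmult_assoc, Rinv_l, Rmult_1_r in Hfin by lra.
  unfold n in Hfin. rewrite !S_INR in Hfin. lra.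
Qed.

(* The critical radius is the supremum of the p with p^n <= gamma (A^n) for all n. *)
Lemma gamma_power_lt r : 0 < r -> rho_ess L nrm A < r ->
  exists n, (1 <= n)%nat /\ gam (Nat.iter n A) < r ^ n.
Proof.
  intros Hr Hess. apply NNPP. intro Hno. assert (HB := proj1 HA).
  set (E := fun p => 0 < p /\ forall n, (1 <= n)%nat -> p ^ n <= gam (Nat.iter n A)).
  assert (Er : E r).
  { split; auto. intros n Hn. apply Rnot_lt_le. intro H. apply Hno. now exists n. }
  destruct (completeness E) as [rho [Hub Hlub]].
  - exists (gam A). intros p [_ Hp]. specialize (Hp 1%nat (Nat.le_refl 1)).
    rewrite pow_1 in Hp. exact Hp.
  - now exists r.
  - assert (Hrr : r <= rho) by now apply Hub.
    assert (Hin : ess_spectrum L nrm A (RtoC rho)).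
    { apply ess_spectrum_of_growth; [lra| |].
      - intros n Hn. set (g := gam (Nat.iter n A)).
        assert (Hg : 0 < g) by (destruct Er as [_ Er]; specialize (Er n Hn);
          assert (P := pow_lt r n Hr); unfold g; lra).
        (* The n-th root of g bounds all of E, hence also its supremum rho; so rho itself satisfies
           rho^n <= g. *)
        assert (Hroot : Rpower g (/ INR n) ^ n = g).
        { rewrite <- Rpower_pow by apply exp_pos. rewrite Rpower_mult, Rinv_l, Rpower_1; auto.
          apply not_0_INR. lia. }
        rewrite <- Hroot. apply pow_incr. split; [lra|]. apply Hlub.
        intros p [Hp1 Hp2]. apply Rnot_lt_le. intro Hlt.
        specialize (Hp2 n Hn). fold g in Hp2. rewrite <- Hroot in Hp2.
        assert (Rpower g (/ INR n) ^ n < p ^ n); [|lra].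
        apply pow_lt_compat; [apply Rlt_le, exp_pos | exact Hlt | lia].
      - intros mu Hmu. apply NNPP. intro Hno'. assert (mu <= rho); [|lra].
        apply Hub. split; [lra|]. intros n Hn. apply Rnot_lt_le. intro. apply Hno'. now exists n. }
    apply (rho_ess_spec A HB) in Hin. rewrite Cmod_R, Rabs_pos_eq in Hin by lra. lra.
Qed.

End Resolvent.

(** * Geometric means of positive operators *)

Lemma tail_vsum N m F : tail N (vsum m F) = vsum m (fun k => tail N (F k)).
Proof.
  induction m as [|m IH]; simpl.
  - apply functional_extensionality. intro i. unfold tail, czero.
    now destruct (Nat.ltb i N).
  - now rewrite tail_add, IH.
Qed.

Lemma fst_vsum m F i : fst (vsum m F i) = bigsum m (fun k => fst (F k i)).
Proof.
  induction m as [|m IH]; simpl; auto. unfold cadd. simpl. now rewrite IH.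
Qed.

(** Stated for an operator whose entries lie below the geometric mean, so that it applies to powers
    of a Hadamard product too. The weighted sum B of the factors dominates T in the rows from N on,
    and the weights make the tail bound of B equal to the product G. *)
Lemma gamma_geometric_mean m (alpha : nat -> R) T (Ts : nat -> cseq -> cseq) :
  (forall k, (k < m)%nat -> 0 < alpha k) -> 1 <= bigsum m alpha ->
  bop T -> (forall k, (k < m)%nat -> pos (Ts k)) ->
  (forall i j, inI I j = true -> Cmod (T (unitvec j) i) <=
     bigprod m (fun k => rpow (fst (Ts k (unitvec j) i)) (alpha k))) ->
  gam T <= bigprod m (fun k => rpow (gam (Ts k)) (alpha k)).
Proof.
  intros Ha Hs HT HTs Hent.
  assert (HG : forall k, (k < m)%nat -> 0 <= gam (Ts k))
    by (intros; now apply gamma_ge0, HTs).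
  apply le_bigprod_rpow_limit; auto. intros e He.
  set (c := fun k => gam (Ts k) + e).
  destruct (eventually_all m (fun k n => forall x, L x -> nrm (tail n (Ts k x)) <= c k * nrm x))
    as [N HN].
  { intros k Hk. apply gamma_tail; [now apply HTs | unfold c; lra]. }
  set (G := bigprod m (fun k => rpow (gam (Ts k) + e) (alpha k))).
  assert (HG0 : 0 <= G) by (apply bigprod_ge0; intros; apply rpow_ge0).
  set (w := fun k => G * (alpha k / bigsum m alpha / c k)).
  assert (Hc : forall k, (k < m)%nat -> 0 < c k).
  { intros k Hk. unfold c. specialize (HG k Hk). lra. }
  assert (Hw : forall k, (k < m)%nat -> 0 <= w k).
  { intros k Hk. apply Rmult_le_pos; auto. apply Rlt_le.
    repeat apply Rdiv_lt_0_compat; auto. lra. }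
  set (B := fun x => vsum m (fun k => cscale (RtoC (w k)) (Ts k x))).
  assert (HB : bop B).
  { apply (bop_vsum m (fun k x => cscale (RtoC (w k)) (Ts k x))).
    intros k Hk. now apply bop_cscale, HTs. }
  apply (gamma_le_of_tail T N); auto.
  apply (tail_op_domination T B N); auto.
  - intros i j Hi Hj.
    (* The mean inequality needs entries at most [c k]. From row N on they are coordinates of the
       tail of the image of a unit vector, which has norm at most [c k]. *)
    assert (E : forall k, (k < m)%nat ->
      0 <= fst (Ts k (unitvec j) i) <= c k /\ snd (Ts k (unitvec j) i) = 0).
    { intros k Hk. destruct (positive_entry (Ts k) i j (HTs k Hk) Hj) as [E1 E2].
      split; auto. split; auto. destruct (L_unitvec j Hj) as [Lu Nu].
      assert (P := HN k Hk _ Lu). rewrite Nu, Rmult_1_r in P.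
      rewrite <- Cmod_real_nonneg by auto. eapply Rle_trans; [|exact P].
      assert (Q := coord_le_nrm (tail N (Ts k (unitvec j))) i
        (L_tail _ _ (bop_L _ _ (proj1 (HTs k Hk)) Lu))).
      unfold tail at 1 in Q. destruct (Nat.ltb_spec i N); [lia | exact Q]. }
    split.
    + apply (vsum_nonneg m (fun k => cscale (RtoC (w k)) (Ts k (unitvec j)))).
      intros k Hk. apply nonneg_scale; auto. apply (HTs k Hk); [now apply L_unitvec|].
      apply unitvec_nonneg.
    + eapply Rle_trans; [now apply Hent|]. unfold B. rewrite fst_vsum.
      rewrite (bigsum_ext m _ (fun k => w k * fst (Ts k (unitvec j) i)))
        by (intros; apply fst_cscale_R).
      apply (weighted_amgm_scaled m alpha Ha Hs (fun k => fst (Ts k (unitvec j) i)) c).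
      intros k Hk. split; [auto|]. now apply E.
  - intros x Hx. unfold B. rewrite tail_vsum.
    apply Rle_trans with (bigsum m (fun k => w k * (c k * nrm x))).
    + apply nrm_vsum; intros k Hk.
      * apply L_tail, L_scale, bop_L; auto. now apply HTs.
      * rewrite tail_scale, nrm_scale, Cmod_R, Rabs_pos_eq
          by (auto; apply L_tail, bop_L; auto; now apply HTs).
        apply Rmult_le_compat_l; auto.
    + rewrite (bigsum_ext m _ (fun k => nrm x * (G * (alpha k / bigsum m alpha)))).
      * rewrite bigsum_scal, bigsum_weights by auto. right. ring.
      * intros k Hk. specialize (Hc k Hk). unfold w. field. lra.
Qed.

(** * Nonnegative matrices *)

Section Matrices.

Context (a : rmatrix) (Ha : nonneg_matrix a).

Lemma ex_series_matrow (f : C -> R) (i : nat) (x : cseq) :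
  (forall z, Rabs (f z) <= Cmod z) -> ex_series (fun j => a i j * Cmod (x j)) ->
  ex_series (fun j => a i j * f (x j)).
Proof.
  intros Hf H.
  apply (ex_series_le (K := R_AbsRing) (V := R_CompleteNormedModule)
    _ (fun j => a i j * Cmod (x j))); [|exact H].
  intro j. change (norm (a i j * f (x j))) with (Rabs (a i j * f (x j))).
  rewrite Rabs_mult, (Rabs_pos_eq (a i j)) by apply Ha.
  apply Rmult_le_compat_l; [apply Ha | apply Hf].
Qed.

Lemma ex_series_fst (i : nat) (x : cseq) : ex_series (fun j => a i j * Cmod (x j)) ->
  ex_series (fun j => a i j * fst (x j)) /\ ex_series (fun j => a i j * snd (x j)).
Proof.
  intro H. split; apply ex_series_matrow; auto; intro z.
  - exact (Rle_trans _ _ _ (Rmax_l _ _) (Rmax_Cmod z)).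
  - exact (Rle_trans _ _ _ (Rmax_r _ _) (Rmax_Cmod z)).
Qed.

Lemma fst_matapp_cabs (i : nat) (x : cseq) : inI I i = true ->
  fst (matapp I a (cabs x) i) = Series (fun j => a i j * Cmod (x j)).
Proof. intro Hi. unfold matapp. now rewrite Hi. Qed.

Lemma matapp_nonneg (x : cseq) : L x -> defines_op I L a -> nonnegseq x ->
  nonnegseq (matapp I a x).
Proof.
  intros Hx Hd Nx i. unfold matapp. destruct (inI I i) eqn:Hi; [|simpl; lra]. simpl. split.
  - rewrite <- Series_zero. apply Series_le.
    + intro j. destruct (Nx j) as [P _]. assert (Q := Ha i j). split; [lra | nra].
    + apply ex_series_fst. now apply Hd.
  - apply is_series_unique.
    apply (is_series_ext (fun _ : nat => 0)); [|exact is_series_zero].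
    intro j. destruct (Nx j) as [_ ->]. symmetry. apply Rmult_0_r.
Qed.

(** The factor 2 comes from estimating real and imaginary parts separately. It is harmless, because
    the lemma only serves membership in L and boundedness. *)
Lemma Cmod_matapp_le (i : nat) (x : cseq) : inI I i = true ->
  ex_series (fun j => a i j * Cmod (x j)) ->
  Cmod (matapp I a x i) <= 2 * Series (fun j => a i j * Cmod (x j)).
Proof.
  intros Hi H. destruct (ex_series_fst i x H) as [H1 H2].
  assert (Hcomp : forall f : C -> R, (forall z, Rabs (f z) <= Cmod z) ->
    Rabs (Series (fun j => a i j * f (x j))) <= Series (fun j => a i j * Cmod (x j))).
  { intros f Hf. assert (Hle : forall j, 0 <= Rabs (a i j * f (x j)) <= a i j * Cmod (x j)).
    { intro j. split; [apply Rabs_pos|]. rewrite Rabs_mult, (Rabs_pos_eq (a i j)) by apply Ha.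
      apply Rmult_le_compat_l; [apply Ha | apply Hf]. }
    eapply Rle_trans; [apply Series_Rabs|].
    - apply (ex_series_ext (fun j => a i j * Rabs (f (x j)))).
      + intro j. now rewrite Rabs_mult, (Rabs_pos_eq (a i j)) by apply Ha.
      + apply (ex_series_matrow (fun z => Rabs (f z))); auto.
        intro z. now rewrite Rabs_Rabsolu.
    - apply Series_le; [exact Hle | exact H]. }
  eapply Rle_trans; [apply Cmod_le_sum|]. unfold matapp. rewrite Hi. simpl.
  assert (P := Hcomp fst (fun z => Rle_trans _ _ _ (Rmax_l _ _) (Rmax_Cmod z))).
  assert (Q := Hcomp snd (fun z => Rle_trans _ _ _ (Rmax_r _ _) (Rmax_Cmod z))). lra.
Qed.

Context (Hd : defines_op I L a).

Lemma nrm_matapp_le (x : cseq) : L x -> nrm (matapp I a x) <= 2 * nrm (matapp I a (cabs x)).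
Proof.
  intro Hx. assert (LA := proj2 (Hd _ (L_cabs x Hx))).
  replace 2 with (Cmod (RtoC 2)) by (rewrite Cmod_R; apply Rabs_pos_eq; lra).
  rewrite <- nrm_scale by auto. apply solid; [now apply L_scale|].
  intro i. unfold cscale. rewrite Cmod_mult, Cmod_R, Rabs_pos_eq by lra.
  destruct (inI I i) eqn:Hi.
  - eapply Rle_trans; [apply Cmod_matapp_le; auto; now apply (proj1 (Hd x Hx))|].
    rewrite <- fst_matapp_cabs by auto. apply Rmult_le_compat_l; [lra|].
    rewrite Cmod_real_nonneg; [lra| |]; now apply matapp_nonneg; auto using L_cabs, cabs_nonneg.
  - unfold matapp. rewrite Hi, Cmod_0. lra.
Qed.

Lemma matapp_add (x y : cseq) : L x -> L y ->
  matapp I a (cadd x y) = cadd (matapp I a x) (matapp I a y).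
Proof.
  intros Hx Hy. apply functional_extensionality. intro i. unfold matapp, cadd.
  destruct (inI I i) eqn:Hi; [|ring].
  destruct (ex_series_fst i x) as [X1 X2]; [now apply Hd|].
  destruct (ex_series_fst i y) as [Y1 Y2]; [now apply Hd|].
  unfold Cplus. simpl. f_equal; rewrite <- Series_plus by auto; apply Series_ext; intro; ring.
Qed.

Lemma matapp_scale (c : C) (x : cseq) : L x ->
  matapp I a (cscale c x) = cscale c (matapp I a x).
Proof.
  intros Hx. apply functional_extensionality. intro i. unfold matapp, cscale.
  destruct (inI I i) eqn:Hi; [|ring].
  destruct (ex_series_fst i x) as [X1 X2]; [now apply Hd|].
  unfold Cmult. simpl. f_equal.
  - rewrite <- !Series_scal_l, <- Series_minus by
      now apply (ex_series_scal (V := R_NormedModule)).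
    apply Series_ext. intro. ring.
  - rewrite <- !Series_scal_l, <- Series_plus by
      now apply (ex_series_scal (V := R_NormedModule)).
    apply Series_ext. intro. ring.
Qed.

Lemma matapp_le (x y : cseq) : L x -> L y -> nonnegseq x ->
  (forall i, fst (x i) <= fst (y i)) -> nonnegseq y ->
  nrm (matapp I a x) <= nrm (matapp I a y).
Proof.
  intros Hx Hy Nx Hle Ny.
  assert (Nd : nonnegseq (csub y x)).
  { intro k. unfold csub. simpl. destruct (Nx k) as [_ ->], (Ny k) as [_ ->].
    specialize (Hle k). split; lra. }
  assert (Ly := matapp_nonneg _ (L_sub _ _ Hy Hx) Hd Nd).
  apply solid; [now apply Hd|]. intro i.
  destruct (matapp_nonneg x Hx Hd Nx i) as [X1 X2].
  destruct (matapp_nonneg y Hy Hd Ny i) as [Y1 Y2].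
  rewrite !Cmod_real_nonneg by auto.
  destruct (Ly i) as [P _].
  rewrite csub_add_opp, matapp_add, matapp_scale in P by auto using L_scale.
  unfold cadd, cscale in P. simpl in P. rewrite X2 in P. lra.
Qed.

(* Otherwise some x_n >= 0 of norm 2^-n have |A x_n| > 2^n, and A (sum x_n) has no norm. *)
Lemma matapp_bounded_nonneg : exists c, forall x, L x -> nonnegseq x ->
  nrm (matapp I a x) <= c * nrm x.
Proof.
  apply NNPP. intro Hno.
  assert (Hz : forall n : nat, exists z, L z /\ nonnegseq z /\ nrm z <= (/ 2) ^ n /\
    2 ^ n <= nrm (matapp I a z)).
  (* A vector violating the bound with constant 4^n, rescaled to norm 2^-n, has an image of norm
     above 2^n. *)
  { intro n. apply NNPP. intro Hn. apply Hno. exists (4 ^ n). intros x Hx Nx.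
    apply Rnot_lt_le. intro Hlt. apply Hn. clear Hn.
    destruct (Req_dec (nrm x) 0) as [H0|H0].
    { rewrite (nrm_eq0 x Hx H0) in Hlt. exfalso.
      replace czero with (cscale (RtoC 0) czero) in Hlt by cseq_ring.
      rewrite matapp_scale, !nrm_scale, Cmod_0 in Hlt by (exact L_zero || apply Hd, L_zero).
      lra. }
    assert (Hp : 0 < nrm x) by (assert (P := nrm_ge0 x Hx); lra).
    assert (P2 : 0 < 2 ^ n) by (apply pow_lt; lra).
    set (r := (/ 2) ^ n / nrm x).
    assert (Hr : 0 < r) by (apply Rdiv_lt_0_compat; auto; apply pow_lt; lra).
    exists (cscale (RtoC r) x). split; [now apply L_scale|].
    split; [apply nonneg_scale; auto; lra|].
    rewrite matapp_scale, !nrm_scale, Cmod_R, Rabs_pos_eq by (auto; try lra; now apply Hd).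
    split.
    - right. unfold r. field. lra.
    - apply Rlt_le. apply Rle_lt_trans with (r * (4 ^ n * nrm x)).
      + right. unfold r. replace 4 with (2 * 2) by ring.
        rewrite Rpow_mult_distr, pow_inv. field. lra.
      + now apply Rmult_lt_compat_l. }
  set (z := fun n => proj1_sig (constructive_indefinite_description _ (Hz n))).
  assert (Hzs : forall n, L (z n) /\ nonnegseq (z n) /\ nrm (z n) <= (/ 2) ^ n /\
    2 ^ n <= nrm (matapp I a (z n)))
    by (intro n; exact (proj2_sig (constructive_indefinite_description _ (Hz n)))).
  assert (Lz : forall n, L (vsum n z)) by (intro; apply L_vsum; intros; apply Hzs).
  assert (Hinc : forall N p, nrm (csub (vsum (N + p) z) (vsum N z))
    <= 2 * (/ 2) ^ N - (/ 2) ^ (N + p) * 2).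
  { intros N p. induction p as [|p IH].
    - rewrite Nat.add_0_r. replace (csub (vsum N z) (vsum N z)) with czero by cseq_ring.
      rewrite nrm_zero. lra.
    - rewrite Nat.add_succ_r. simpl vsum.
      replace (csub (cadd (vsum (N + p) z) (z (N + p)%nat)) (vsum N z))
        with (cadd (csub (vsum (N + p) z) (vsum N z)) (z (N + p)%nat)) by cseq_ring.
      eapply Rle_trans; [apply nrm_add; [now apply L_sub | apply Hzs]|].
      destruct (Hzs (N + p)%nat) as (_ & _ & P & _). simpl pow. lra. }
  destruct (L_complete (fun n => vsum n z) Lz) as (y & Hy & Hcv).
  { intros eps Heps. destruct (pow_lt_1_zero (/ 2)) with (y := eps / 4) as [N HN].
    - rewrite Rabs_pos_eq; lra.
    - lra.
    - exists N. intros p q Hp Hq. specialize (HN N (Nat.le_refl N)).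
      assert (P := Rle_abs ((/ 2) ^ N)).
      assert (Hb : forall r, (N <= r)%nat -> nrm (csub (vsum r z) (vsum N z)) < eps / 2).
      { intros r Hr. replace r with (N + (r - N))%nat by lia.
        eapply Rle_lt_trans; [apply Hinc|].
        assert (0 < (/ 2) ^ (N + (r - N))) by (apply pow_lt; lra). lra. }
      replace (csub (vsum p z) (vsum q z))
        with (csub (csub (vsum p z) (vsum N z)) (csub (vsum q z) (vsum N z))) by cseq_ring.
      eapply Rle_lt_trans; [apply nrm_sub; auto using L_sub|].
      assert (P1 := Hb p Hp). assert (P2 := Hb q Hq). lra. }
  (* Partial sums of nonnegative terms dominate each z_n, and norm convergence implies convergence
     of coordinates. *)
  assert (Hzy : forall n i, fst (z n i) <= fst (cabs y i)).
  { intros n i. apply le_epsilon. intros e He. destruct (Hcv e He) as [N HN].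
    set (p := max N (S n)). specialize (HN p ltac:(unfold p; lia)).
    apply Rle_trans with (fst (vsum p z i)).
    - apply vsum_ge_term; [intros; apply Hzs | unfold p; lia].
    - assert (P := coord_le_nrm _ i (L_sub _ _ (Lz p) Hy)).
      assert (Q : fst (vsum p z i) <= Cmod (vsum p z i)).
      { eapply Rle_trans; [apply Rle_abs|]. eapply Rle_trans; [apply Rmax_l | apply Rmax_Cmod]. }
      unfold cabs. simpl.
      replace (vsum p z i) with (Cplus (csub (vsum p z) y i) (y i)) in Q at 2
        by (unfold csub; ring).
      assert (T := Cmod_triangle (csub (vsum p z) y i) (y i)). lra. }
  destruct (Pow_x_infinity 2) with (b := nrm (matapp I a (cabs y)) + 1) as [N HN].
  { rewrite Rabs_pos_eq; lra. }
  specialize (HN N (Nat.le_refl N)). rewrite Rabs_pos_eq in HN by (apply pow_le; lra).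
  destruct (Hzs N) as (Z1 & Z2 & _ & Z4).
  assert (P := matapp_le (z N) (cabs y) Z1 (L_cabs y Hy) Z2 (Hzy N) (cabs_nonneg y)). lra.
Qed.

(** Automatic continuity: [defines_op] only asks that the matrix maps L into itself. *)
Lemma positive_matapp : pos (matapp I a).
Proof.
  split; [|intros; now apply matapp_nonneg].
  destruct matapp_bounded_nonneg as [c Hc].
  apply (bop_intro _ (2 * c)).
  - intros x Hx. now apply Hd.
  - exact matapp_add.
  - intros. now apply matapp_scale.
  - intros x Hx. eapply Rle_trans; [now apply nrm_matapp_le|].
    assert (P := Hc (cabs x) (L_cabs x Hx) (cabs_nonneg x)). rewrite nrm_cabs in P; auto. lra.
Qed.

Lemma matapp_unitvec i j : inI I i = true -> inI I j = true ->
  matapp I a (unitvec j) i = RtoC (a i j).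
Proof.
  intros Hi Hj. unfold matapp. rewrite Hi. unfold RtoC. f_equal; apply is_series_unique.
  - replace (a i j) with (a i j * fst (unitvec j j))
      by (unfold unitvec; rewrite Nat.eqb_refl; simpl; ring).
    apply (is_series_single (fun k => a i k * fst (unitvec j k)) j).
    intros k Hk. unfold unitvec. destruct (Nat.eqb_spec k j); [easy|]. apply Rmult_0_r.
  - apply (is_series_ext (fun _ : nat => 0)); [|exact is_series_zero].
    intro k. unfold unitvec. symmetry. destruct (Nat.eqb k j); apply Rmult_0_r.
Qed.

Lemma ex_series_fst_nonneg i x : inI I i = true -> L x -> ex_series (fun j => a i j * fst (x j)).
Proof. intros Hi Hx. apply ex_series_fst. now apply Hd. Qed.

End Matrices.

(** * Hadamard products of powers *)

Section Hadamard.

Context (m : nat) (A : nat -> rmatrix) (alpha : nat -> R).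
Context (HA : forall k, (k < m)%nat -> nonneg_matrix (A k) /\ defines_op I L (A k)).
Context (Halpha : forall k, (k < m)%nat -> 0 < alpha k) (Hsum : 1 <= bigsum m alpha).

Let H := hadamard m A alpha.

Lemma hadamard_nonneg : nonneg_matrix H.
Proof. intros i j. apply bigprod_ge0. intros; apply rpow_ge0. Qed.

Lemma positive_factor k : (k < m)%nat -> pos (matapp I (A k)).
Proof. intro Hk. destruct (HA k Hk). now apply positive_matapp. Qed.

(** Entries of [A k] are bounded by its operator norm, since unit vectors have norm 1, so the scaled
    mean inequality holds for all entries. From the sum H inherits convergence of its rows and
    invariance of L. *)
Lemma hadamard_le_weighted_sum : exists w : nat -> R,
  (forall k, (k < m)%nat -> 0 <= w k) /\
  forall i j, inI I i = true -> inI I j = true -> H i j <= bigsum m (fun k => w k * A k i j).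
Proof.
  assert (Hc : forall k, exists c, (k < m)%nat -> 0 < c /\
    forall x, L x -> nrm (matapp I (A k) x) <= c * nrm x).
  { intro k. destruct (Nat.lt_ge_cases k m) as [Hk|Hk]; [|exists 0; lia].
    destruct (bop_bound _ (proj1 (positive_factor k Hk))) as [c Hc]. now exists c. }
  set (c := fun k => proj1_sig (constructive_indefinite_description _ (Hc k))).
  assert (Hcs : forall k, (k < m)%nat -> 0 < c k /\
    forall x, L x -> nrm (matapp I (A k) x) <= c k * nrm x)
    by (intro k; exact (proj2_sig (constructive_indefinite_description _ (Hc k)))).
  exists (fun k => bigprod m (fun k => rpow (c k) (alpha k)) * (alpha k / bigsum m alpha / c k)).
  split.
  - intros k Hk. apply Rmult_le_pos.
    + apply bigprod_ge0. intros; apply rpow_ge0.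
    + apply Rlt_le. repeat apply Rdiv_lt_0_compat; auto; [lra | now apply Hcs].
  - intros i j Hi Hj. apply (weighted_amgm_scaled m alpha Halpha Hsum (fun k => A k i j)).
    intros k Hk. destruct (Hcs k Hk) as [Hc0 Hcb]. split; auto. split; [now apply HA|].
    destruct (L_unitvec j Hj) as [Lu Nu]. specialize (Hcb _ Lu).
    rewrite Nu, Rmult_1_r in Hcb. eapply Rle_trans; [|exact Hcb].
    eapply Rle_trans; [|apply (coord_le_nrm _ i); now apply HA].
    rewrite matapp_unitvec, Cmod_R by auto. apply Rle_abs.
Qed.

Lemma hadamard_defines_op : defines_op I L H.
Proof.
  destruct hadamard_le_weighted_sum as (w & Hw & Hle). intros x Hx.
  set (B := vsum m (fun k => cscale (RtoC (w k)) (matapp I (A k) (cabs x)))).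
  assert (LB : L B).
  { apply L_vsum. intros k Hk. apply L_scale, HA; auto using L_cabs. }
  assert (NB : nonnegseq B).
  { apply vsum_nonneg. intros k Hk. apply nonneg_scale; auto.
    apply positive_factor; auto using L_cabs, cabs_nonneg. }
  assert (Hrow : forall i, inI I i = true ->
    ex_series (fun j => H i j * Cmod (x j)) /\
    Series (fun j => H i j * Cmod (x j)) <= fst (B i)).
  { intros i Hi. apply series_le_of_partial.
    - intro j. apply Rmult_le_pos; [apply hadamard_nonneg | apply Cmod_ge_0].
    - intro N. unfold B. rewrite fst_vsum.
      apply Rle_trans with
        (sum_n (fun j => bigsum m (fun k => w k * (A k i j * Cmod (x j)))) N).
      + apply sum_n_le_ext. intros j _.
        destruct (inI I j) eqn:Hj.
        * rewrite (bigsum_ext m _ (fun k => Cmod (x j) * (w k * A k i j))) by (intros; ring).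
          rewrite bigsum_scal, Rmult_comm. apply Rmult_le_compat_l; auto. apply Cmod_ge_0.
        * rewrite (L_supported x Hx j Hj), Cmod_0, Rmult_0_r.
          apply bigsum_ge0. intros; rewrite Rmult_0_r. lra.
      + rewrite (sum_n_bigsum m w (fun k j => A k i j * Cmod (x j))).
        apply bigsum_le. intros k Hk. rewrite fst_cscale_R, fst_matapp_cabs by auto.
        apply Rmult_le_compat_l; auto. apply sum_n_le_series.
        * intro j. apply Rmult_le_pos; [now apply HA | apply Cmod_ge_0].
        * now apply (HA k Hk). }
  split; [intros i Hi; now apply Hrow|].
  apply (solid _ (cscale (RtoC 2) B)); [now apply L_scale|].
  intro i. unfold cscale. rewrite Cmod_mult, Cmod_R, Rabs_pos_eq by lra.
  destruct (NB i) as [N1 N2]. rewrite (Cmod_real_nonneg (B i)) by auto.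
  destruct (inI I i) eqn:Hi.
  - destruct (Hrow i Hi) as [R1 R2].
    assert (P := Cmod_matapp_le H hadamard_nonneg i x Hi R1). lra.
  - unfold matapp. rewrite Hi, Cmod_0. lra.
Qed.

Lemma positive_hadamard : pos (matapp I H).
Proof. apply positive_matapp; [exact hadamard_nonneg | exact hadamard_defines_op]. Qed.

(** Induction by one more factor on the left: each coordinate is a row sum, to whose terms the
    induction hypothesis applies, and Hoelder's inequality for partial sums moves the sum inside the
    product. *)
Lemma hadamard_iter_le n i j : inI I j = true ->
  fst (Nat.iter n (matapp I H) (unitvec j) i) <=
  bigprod m (fun k => rpow (fst (Nat.iter n (matapp I (A k)) (unitvec j) i)) (alpha k)).
Proof.
  intro Hj. destruct (L_unitvec j Hj) as [Lu _]. revert i.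
  induction n as [|n IH]; intro i.
  - simpl. unfold unitvec. destruct (Nat.eqb i j); simpl.
    + right. rewrite (bigprod_rpow_const m alpha 1) by lra. symmetry. apply Rpower_1_base.
    + apply bigprod_ge0. intros; apply rpow_ge0.
  - set (v := Nat.iter n (matapp I H) (unitvec j)) in *.
    set (u := fun k => Nat.iter n (matapp I (A k)) (unitvec j)).
    assert (Hv : L v /\ nonnegseq v).
    { destruct (positive_iter _ n positive_hadamard) as [P Q].
      split; [now apply bop_L | apply Q; auto using unitvec_nonneg]. }
    assert (Hu : forall k, (k < m)%nat -> L (u k) /\ nonnegseq (u k)).
    { intros k Hk. destruct (positive_iter _ n (positive_factor k Hk)) as [P Q].
      split; [now apply bop_L | apply Q; auto using unitvec_nonneg]. }
    change (Nat.iter (S n) (matapp I H) (unitvec j)) with (matapp I H v).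
    rewrite (bigprod_ext m _ (fun k => rpow (fst (matapp I (A k) (u k) i)) (alpha k)))
      by reflexivity.
    unfold matapp at 1. destruct (inI I i) eqn:Hi;
      [|apply bigprod_ge0; intros; apply rpow_ge0].
    unfold fst at 1. apply series_le_of_partial.
    { intro l. apply Rmult_le_pos; [apply hadamard_nonneg | apply Hv]. }
    intro N.
    apply Rle_trans with (sum_n (fun l => bigprod m (fun k =>
      rpow (A k i l * fst (u k l)) (alpha k))) N).
    + apply sum_n_le_ext. intros l _.
      rewrite (bigprod_ext m _ (fun k => rpow (A k i l) (alpha k) * rpow (fst (u k l)) (alpha k)))
        by (intros k Hk; apply rpow_mult; [now apply HA | now apply Hu]).
      rewrite bigprod_mult. apply Rmult_le_compat_l; [apply hadamard_nonneg | apply IH].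
    + eapply Rle_trans.
      { apply (hoelder_sum m alpha Halpha Hsum (fun k l => A k i l * fst (u k l))).
        intros k l Hk. apply Rmult_le_pos; [now apply HA | now apply Hu]. }
      apply bigprod_le. intros k Hk. split; [apply rpow_ge0|].
      apply rpow_le; [now apply Rlt_le, Halpha|]. unfold matapp. rewrite Hi. simpl.
      destruct (HA k Hk) as [HA1 HA2]. destruct (Hu k Hk) as [Lk Nk].
      apply sum_n_le_series.
      * intro l. apply Rmult_le_pos; [apply HA1 | apply Nk].
      * now apply ex_series_fst_nonneg.
Qed.

(** The case n = 1 is the inequality for the measure of noncompactness; all n together yield the one
    for the radius. *)
Lemma gamma_hadamard_iter n :
  gam (Nat.iter n (matapp I H)) <=
  bigprod m (fun k => rpow (gam (Nat.iter n (matapp I (A k)))) (alpha k)).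
Proof.
  assert (PH := positive_iter _ n positive_hadamard).
  apply gamma_geometric_mean; auto.
  - apply PH.
  - intros k Hk. now apply positive_iter, positive_factor.
  - intros i j Hj. destruct (positive_entry _ i j PH Hj).
    rewrite Cmod_real_nonneg by auto. now apply hadamard_iter_le.
Qed.

Lemma rho_ess_hadamard :
  rho_ess L nrm (matapp I H) <=
  bigprod m (fun k => rpow (rho_ess L nrm (matapp I (A k))) (alpha k)).
Proof.
  apply rho_ess_spec; [apply positive_hadamard | apply bigprod_ge0; intros; apply rpow_ge0|].
  intros lam Hlam.
  assert (Hrho : forall k, (k < m)%nat -> 0 <= rho_ess L nrm (matapp I (A k)))
    by (intros k Hk; now apply rho_ess_spec, positive_factor).
  apply le_bigprod_rpow_limit; auto. intros e He.
  set (r := fun k => rho_ess L nrm (matapp I (A k)) + e).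
  assert (Hr : forall k, (k < m)%nat -> 0 < r k)
    by (intros k Hk; specialize (Hrho k Hk); unfold r; lra).
  (* Each factor comes with its own exponent from [gamma_power_lt]. The estimate passes to multiples
     of an exponent, so a product of the exponents serves all factors. *)
  assert (Hn : forall m', (m' <= m)%nat -> exists n, (1 <= n)%nat /\
    forall k, (k < m')%nat -> gam (Nat.iter n (matapp I (A k))) <= r k ^ n).
  { induction m' as [|m' IH]; intro Hm; [exists 1%nat; split; [lia|intros; lia]|].
    destruct IH as (n & Hn & Hall); [lia|].
    destruct (gamma_power_lt _ (positive_factor m' ltac:(lia)) (r m')) as (n' & Hn' & Hlt);
      [apply Hr; lia | unfold r; lra|].
    exists (n * n')%nat. split; [nia|]. intros k Hk.
    assert (Bk : bop (matapp I (A k))) by (apply positive_factor; lia).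
    destruct (Nat.eq_dec k m') as [->|Hne].
    - rewrite (Nat.mul_comm n), iter_mul, pow_mult.
      eapply Rle_trans; [apply gamma_iter; now apply bop_iter|].
      apply pow_incr. split; [apply gamma_ge0; now apply bop_iter | lra].
    - rewrite iter_mul, pow_mult.
      eapply Rle_trans; [apply gamma_iter; now apply bop_iter|].
      apply pow_incr. split; [apply gamma_ge0; now apply bop_iter | apply Hall; lia]. }
  destruct (Hn m (Nat.le_refl m)) as (n & Hn1 & Hall).
  set (P := bigprod m (fun k => rpow (r k) (alpha k))).
  assert (HP : 0 <= P) by (apply bigprod_ge0; intros; apply rpow_ge0).
  apply Rnot_lt_le. intro Hlt.
  assert (Hpow : Cmod lam ^ n <= P ^ n).
  { eapply Rle_trans; [apply ess_spectrum_le_gamma; [apply positive_hadamard | exact Hlam]|].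
    eapply Rle_trans; [apply gamma_hadamard_iter|]. unfold P. rewrite <- bigprod_pow.
    apply bigprod_le. intros k Hk. split; [apply rpow_ge0|].
    rewrite <- rpow_pow by now apply Rlt_le, Hr.
    apply rpow_le; [now apply Rlt_le, Halpha | auto]. }
  assert (P ^ n < Cmod lam ^ n) by now apply pow_lt_compat.
  lra.
Qed.

End Hadamard.

End SequenceSpace.

Theorem theorem3p4 (I : IndexSet) (L : cseq -> Prop) (nrm : cseq -> R)
  (m : nat) (A : nat -> rmatrix) (alpha : nat -> R) :
  in_calL I L nrm ->
  order_continuous L nrm ->
  dual_order_continuous L nrm ->
  (forall k, (k < m)%nat -> nonneg_matrix (A k) /\ defines_op I L (A k)) ->
  (forall k, (k < m)%nat -> 0 < alpha k) ->
  1 <= bigsum m alpha ->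
  gammaH L nrm (matapp I (hadamard m A alpha))
    <= bigprod m (fun k => rpow (gammaH L nrm (matapp I (A k))) (alpha k)) /\
  rho_ess L nrm (matapp I (hadamard m A alpha))
    <= bigprod m (fun k => rpow (rho_ess L nrm (matapp I (A k))) (alpha k)).
Proof.
  intros HL OC _ HA Halpha Hsum. split.
  - exact (gamma_hadamard_iter HL OC m A alpha HA Halpha Hsum 1).
  - exact (rho_ess_hadamard HL OC m A alpha HA Halpha Hsum).
Qed.
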